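(* Let $f:\mathbb{C}^n\to\mathbb{C}^n$ be an analytic map and let $r,\delta>0$. Then every island, i.e. every connected component of $f^{-1}(B_\delta)\cap B_r$ which is disjoint from $S_r=\partial B_r$, has non-empty interior, and this interior contains at least one zero of $f$.
   Context: $B_r\subset\mathbb{C}^n$ is the closed Euclidean ball of radius $r$ centered at $0$, and $f^{-1}(B_\delta)\cap B_r=\{z\in B_r:|f(z)|\le\delta\}$. A connected component of $f^{-1}(B_\delta)\cap B_r$ is called an island if it is disjoint from $S_r=\partial B_r$. ''Analytic'' means holomorphic on all of $\mathbb{C}^n$; $n\ge1$. *)

(* Defs.v *)
From HB Require Import structures.
From mathcomp Require Import all_boot all_order all_algebra.
From mathcomp Require Import complex.
From mathcomp Require Import all_classical all_reals all_analysis.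
Set Implicit Arguments.
Unset Strict Implicit.
Unset Printing Implicit Defensive.
Import Order.TTheory GRing.Theory Num.Theory.
Import numFieldNormedType.Exports.
Local Open Scope classical_set_scope.
Local Open Scope ring_scope.

(* MathComp-Analysis puts the topology of a numeric field on R[i]^o only; this
   makes it available on R[i], hence on 'rV[R[i]]_n (product topology, given by
   the sup norm, i.e. the usual topology of C^n). *)
HB.instance Definition _ (R : rcfType) := NormedModule.copy R[i] R[i]^o.

(* The library norm `|z| on 'rV[R[i]]_n is the sup norm, not this one. *)
Definition enorm (R : realType) (n : nat) (z : 'rV[R[i]]_n) : R :=
  Num.sqrt (\sum_(i < n) (complex.Re (z ord0 i) ^+ 2
                          + complex.Im (z ord0 i) ^+ 2)).

Definition eball (R : realType) (n : nat) (r : R) : set 'rV[R[i]]_n :=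
  [set z | enorm z <= r].

Definition frontier (T : topologicalType) (A : set T) : set T :=
  closure A `\` A°.

Definition esphere (R : realType) (n : nat) (r : R) : set 'rV[R[i]]_n :=
  frontier (@eball R n r).

(* [differentiable] is taken over the field R[i]: the differential is
   R[i]-linear, which is holomorphy. *)
Definition holomorphic (R : realType) (m n : nat)
    (f : 'rV[R[i]]_m -> 'rV[R[i]]_n) : Prop :=
  forall z, differentiable f z.

(* The condition A x matters: connected_component A x is empty otherwise. *)
Definition is_component (T : topologicalType) (A K : set T) : Prop :=
  exists2 x, A x & K = connected_component A x.

Definition island (R : realType) (n : nat) (f : 'rV[R[i]]_n -> 'rV[R[i]]_n)
    (r delta : R) (K : set 'rV[R[i]]_n) : Prop :=
  is_component ((f @^-1` @eball R n delta) `&` @eball R n r) K /\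
  K `&` @esphere R n r = set0.

(* Main.v *)
Require Import Defs.
From HB Require Import structures.
From mathcomp Require Import all_boot all_order all_algebra.
From mathcomp Require Import complex.
From mathcomp Require mpoly.
From mathcomp Require Import ring lra zify.
Set Implicit Arguments.
Unset Strict Implicit.
Unset Printing Implicit Defensive.
Import Order.TTheory GRing.Theory Num.Theory.
Local Open Scope ring_scope.

(** Only the existence of a zero in the island [K] needs work.  If [f z = 0] with
    [z] in [K], then [z] lies off the sphere and [|f z| < delta], so a whole ball
    around [z] lies in f^-1(B_delta) and in B_r; being connected, it lies in [K]
    ([zero_interior]).

    Suppose that [K] contains no zero of [f].  In the compact set
    A = f^-1(B_delta) `&` B_r the component [K] is an intersection of relatively
    clopen sets, so one of them, A0, contains a point [p] of [K] and meets neither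
    the sphere nor the zeros of [f] ([component_avoids]).  A small compact
    neighbourhood [W] of A0 then lies in the open ball and contains no zero of [f],
    and |f| > delta >= |f p| on its boundary.  These strict inequalities survive a
    small perturbation of [f] ([perturbation]), and the perturbation can be chosen
    to be a multiple of a polynomial map F with F_i = z_i^N + Q_i, deg Q_i < N
    ([holomorphic_approx]).  The minimum of |F| over [W] is attained at an interior
    point and is not 0.  But F is an open map ([polymap_open]), so that near this
    point it takes the value t F(z0) for t slightly less than 1: a contradiction.

    F is open because it is finite and flat.  By comparing leading monomials,
    C[z_1, .., z_n] is a free module over C[F_1, .., F_n], with the monomials of
    partial degrees < N as a basis.  Multiplication by a polynomial g becomes a
    matrix over C[y]; at a point w its eigenvalues are exactly the values of g on the
    fibre F^-1(w), and its determinant, a polynomial in w, is the norm of g.  Choose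
    g to vanish at z0 and at no other point of the fibre of z0.  As w tends to F(z0)
    the norm of g tends to 0, so some point of the fibre over w makes g small, and
    F being proper that point is near z0.

    Polynomial approximation rests on Cauchy's formula, proved here without
    integrals: path integrals are replaced by midpoint sums over dyadic partitions,
    which are exactly additive under subdivision and exact on affine functions.
    Goursat's bisection argument applies to them verbatim ([goursat_square]).  The
    formula writes [f], up to a uniformly small error, as a finite combination of
    functions of fewer variables and of kernels 1/(zeta - z), and an induction on
    the number of variables concludes ([polynomial_density]). *)

(** * Finite polynomial maps and the norm of a polynomial over their fibres *)

Module FiniteMap.
Import mpoly.

Lemma mpoly_ring_ind (R : numClosedFieldType) (n : nat) (P : {mpoly R[n]} -> Prop) :
  (forall c, P c%:MP) -> (forall i, P 'X_i) ->
  (forall p q, P p -> P q -> P (p + q)) -> (forall p q, P p -> P q -> P (p * q)) ->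
  forall p, P p.
Proof.
move=> PC PX PD PM p; rewrite [p]mpolyE; apply: (big_ind P) => //; first exact: (PC 0).
move=> m _; rewrite -mul_mpolyC; apply: (PM); first exact: PC.
rewrite mpolyXE_id; apply: (big_ind P) => //; first exact: (PC 1).
by move=> i _; elim: (m i) => [|k IH]; [exact: (PC 1) | rewrite exprS; apply: (PM)].
Qed.

Definition deg_lt (R : nzRingType) (n N : nat) (q : {mpoly R[n]}) := (msize q <= N)%N.

Lemma ex_deg_lt (R : nzRingType) (n : nat) (Q : 'I_n -> {mpoly R[n]}) :
  exists2 N, (0 < N)%N & forall i, deg_lt N (Q i).
Proof.
exists (\max_i msize (Q i)).+1 => // i.
by rewrite /deg_lt leqW // (@leq_bigmax _ (fun i => msize (Q i)) i).
Qed.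

Lemma deg_ltZ (R : comNzRingType) (n N : nat) (c : R) (q : {mpoly R[n]}) :
  deg_lt N q -> exists2 q', deg_lt N q' & forall v, q'.@[v] = c * q.@[v].
Proof.
move=> qN; exists (c *: q) => [|v]; last exact: mevalZ.
exact: leq_trans (msizeZ_le _ _) qN.
Qed.

Lemma meval_le (C : numClosedFieldType) (n N : nat) (q : {mpoly C[n]}) (v : 'I_n -> C) (b : C) :
  deg_lt N.+1 q -> 1 <= b -> (forall i, `|v i| <= b) ->
  `|q.@[v]| <= (\sum_(m <- msupp q) `|q@_m|) * b ^+ N.
Proof.
move=> qN b1 vb; rewrite mevalE mulr_suml.
apply: (le_trans (ler_norm_sum _ _ _)); rewrite big_seq [leRHS]big_seq.
apply: ler_sum => m mq; rewrite normrM ler_wpM2l // normr_prod.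
have mN : (mdeg m <= N)%N by rewrite -ltnS (leq_trans _ qN) // msize_mdeg_lt.
apply: (@le_trans _ _ (b ^+ mdeg m)); last by rewrite ler_weXn2l.
rewrite mdegE -prodrXr; apply: ler_prod => i _; rewrite normr_ge0 normrX /=.
by rewrite lerXn2r ?nnegrE // (le_trans _ (vb i)).
Qed.

Definition polyfun (R : comNzRingType) (n : nat) (f : ('I_n -> R) -> R) :=
  exists p : {mpoly R[n]}, forall v, f v = p.@[v].

Lemma polyfun_cst (R : comNzRingType) n (c : R) : polyfun (fun _ : 'I_n -> R => c).
Proof. by exists c%:MP => v; rewrite mevalC. Qed.

Lemma polyfun_coord (R : comNzRingType) n i : polyfun (fun v : 'I_n -> R => v i).
Proof. by exists 'X_i => v; rewrite mevalXU. Qed.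

Lemma polyfunD (R : comNzRingType) n (f g : ('I_n -> R) -> R) :
  polyfun f -> polyfun g -> polyfun (fun v => f v + g v).
Proof. by move=> [p pE] [q qE]; exists (p + q) => v; rewrite mevalD pE qE. Qed.

Lemma polyfunM (R : comNzRingType) n (f g : ('I_n -> R) -> R) :
  polyfun f -> polyfun g -> polyfun (fun v => f v * g v).
Proof. by move=> [p pE] [q qE]; exists (p * q) => v; rewrite mevalM pE qE. Qed.

Lemma polyfun_bounded (C : numClosedFieldType) n (f : ('I_n -> C) -> C) (b : C) :
  polyfun f -> 1 <= b ->
  exists2 B, 0 <= B & forall v, (forall i, `|v i| <= b) -> `|f v| <= B.
Proof.
move=> [p pE] b1; exists ((\sum_(m <- msupp p) `|p@_m|) * b ^+ msize p).
  by apply: mulr_ge0; [exact: sumr_ge0 | apply/exprn_ge0/le_trans/b1].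
by move=> v vb; rewrite pE; apply: meval_le => //; rewrite /deg_lt ltnW.
Qed.

(** The map is F = (z_i^N + Q_i)_i with deg Q_i < N. *)
Section FiniteMap.
Variables (C : numClosedFieldType) (n N : nat) (Q : 'I_n -> {mpoly C[n]}).
Hypothesis N_gt0 : (0 < N)%N.
Hypothesis degQ : forall i, deg_lt N (Q i).

Definition Pmap : n.-tuple {mpoly C[n]} := [tuple 'X_i ^+ N + Q i | i < n].

Lemma tnth_Pmap i : tnth Pmap i = 'X_i ^+ N + Q i.
Proof. by rewrite tnth_mktuple. Qed.

Lemma meval_Pmap i z : (tnth Pmap i).@[z] = z i ^+ N + (Q i).@[z].
Proof. by rewrite tnth_Pmap mevalD rmorphXn /= mevalXU. Qed.

(** The part of top degree of [p] is the single monomial [m].  Working with total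
    degrees avoids choosing an order on the monomials of equal degree. *)
Definition lt_lead (p : {mpoly C[n]}) (m : 'X_{1..n}) := (msize (p - 'X_[m]) <= mdeg m)%N.

Lemma msize_mul_le (p q : {mpoly C[n]}) a b :
  (msize p <= a)%N -> (msize q <= b.+1)%N -> (msize (p * q) <= a + b)%N.
Proof.
have [->|p0] := eqVneq p 0; first by rewrite mul0r msize0.
have [->|q0] := eqVneq q 0; first by rewrite mulr0 msize0.
by rewrite msizeM //; move: (msize p) (msize q) => x y; lia.
Qed.

Lemma lt_leadX m : lt_lead 'X_[m] m.
Proof. by rewrite /lt_lead subrr msize0. Qed.

Lemma lt_leadM p q m k : lt_lead p m -> lt_lead q k -> lt_lead (p * q) (m + k)%MM.
Proof.
rewrite /lt_lead => pm qk.
have -> : p * q - 'X_[(m + k)] = (p - 'X_[m]) * q + (q - 'X_[k]) * 'X_[m].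
  by rewrite mpolyXD; ring.
rewrite (leq_trans (mmeasureD_le _ _ _)) // geq_max mdegD.
apply/andP; split; last by rewrite addnC msize_mul_le // msizeX.
rewrite msize_mul_le // -[q](subrK 'X_[k]) (leq_trans (mmeasureD_le _ _ _)) //.
by rewrite geq_max msizeX leqnn andbT ltnW.
Qed.

Lemma lt_lead1 : lt_lead 1 0%MM.
Proof. by rewrite -mpolyX0 lt_leadX. Qed.

Lemma lt_lead_exp p m k : lt_lead p m -> lt_lead (p ^+ k) (m *+ k)%MM.
Proof.
move=> pm; elim: k => [|k IH]; first by rewrite expr0 mulm0n lt_lead1.
by rewrite exprS mulmS lt_leadM.
Qed.

Lemma lt_lead_Pmap i : lt_lead (tnth Pmap i) (U_(i) *+ N)%MM.
Proof.
by rewrite /lt_lead tnth_Pmap mpolyXn addrC addKr mdegMn mdeg1 mul1n; exact: degQ.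
Qed.

Lemma lt_lead_comp m : lt_lead ('X_[m] \mPo Pmap) (m *+ N)%MM.
Proof.
rewrite comp_mpolyX.
have -> : (m *+ N)%MM = (\big[mnm_add/0]_(i < n) ((U_(i) *+ N) *+ m i))%MM.
  apply/mnmP => j; rewrite mnm_sumE mulmnE (bigD1 j) //= big1 ?addn0.
    by rewrite !mulmnE mnm1E eqxx mul1n mulnC.
  by move=> i ij; rewrite !mulmnE mnm1E (negbTE ij).
apply: (big_ind2 lt_lead); first exact: lt_lead1.
- by move=> *; apply: lt_leadM.
- by move=> i _; apply/lt_lead_exp/lt_lead_Pmap.
Qed.

Notation idx := {ffun 'I_n -> 'I_N}.
Definition reduced_mnm (b : idx) : 'X_{1..n} := [multinom (b i : nat) | i < n].
Definition quo_mnm (m : 'X_{1..n}) : 'X_{1..n} := [multinom (m i %/ N)%N | i < n].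
Definition rem_mnm (m : 'X_{1..n}) : idx := [ffun i => Ordinal (ltn_pmod (m i) N_gt0)].

(** Euclidean division of the exponents: it matches the monomials of C[z] with the
    pairs (reduced monomial, monomial in the F_i). *)
Lemma quo_rem m : (quo_mnm m *+ N + reduced_mnm (rem_mnm m))%MM = m.
Proof.
by apply/mnmP => i; rewrite mnmDE mulmnE !mnmE ffunE /= -divn_eq.
Qed.

Lemma quo_rem_inj m b m' b' : (m *+ N + reduced_mnm b)%MM = (m' *+ N + reduced_mnm b')%MM ->
  m = m' /\ b = b'.
Proof.
move=> /mnmP e.
have e' i : (m i * N + b i = m' i * N + b' i)%N.
  by have := e i; rewrite !mnmDE !mulmnE !mnmE.
split.
  apply/mnmP => i; have := congr1 (fun x => x %/ N)%N (e' i).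
  by rewrite !divnMDl // !divn_small // !addn0.
apply/ffunP => i; apply/val_inj => /=; have := congr1 (fun x => x %% N)%N (e' i).
by rewrite !modnMDl !modn_small.
Qed.

(** The C[y]-linear map from the free module on the reduced monomials to C[z], where
    y_i acts on C[z] as multiplication by F_i. *)
Definition of_coords (u : {ffun idx -> {mpoly C[n]}}) : {mpoly C[n]} :=
  \sum_b (u b \mPo Pmap) * 'X_[reduced_mnm b].

Lemma of_coordsD u v : of_coords (u + v) = of_coords u + of_coords v.
Proof.
by rewrite /of_coords -big_split; apply: eq_bigr => b _; rewrite ffunE raddfD mulrDl.
Qed.

Lemma of_coords0 : of_coords 0 = 0.
Proof. by rewrite /of_coords big1 // => b _; rewrite ffunE raddf0 mul0r. Qed.

Lemma of_coords_scale (a : {mpoly C[n]}) (u : {ffun idx -> {mpoly C[n]}}) :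
  of_coords [ffun b => a * u b] = (a \mPo Pmap) * of_coords u.
Proof.
by rewrite /of_coords mulr_sumr; apply: eq_bigr => b _; rewrite ffunE rmorphM mulrA.
Qed.

Lemma of_coords_delta (a : {mpoly C[n]}) b0 :
  of_coords [ffun b => if b == b0 then a else 0] = (a \mPo Pmap) * 'X_[reduced_mnm b0].
Proof.
rewrite /of_coords (bigD1 b0) //= ffunE eqxx big1 ?addr0 // => b bb0.
by rewrite ffunE (negbTE bb0) raddf0 mul0r.
Qed.

(** Each monomial z^m is, up to lower degree terms, F^(quo m) z^(rem m): the total
    degree of the remainder decreases. *)
Lemma of_coords_surj p : exists u, of_coords u == p.
Proof.
have [k] := ubnP (msize p); elim: k p => // k IH p; rewrite ltnS => pk.
pose t m := ('X_[quo_mnm m] \mPo Pmap) * 'X_[reduced_mnm (rem_mnm m)].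
have tm m : lt_lead (t m) m.
  by rewrite -[X in lt_lead _ X]quo_rem lt_leadM ?lt_lead_comp ?lt_leadX.
pose p1 := \sum_(m <- msupp p) p@_m *: t m.
have [u1 /eqP u1E] : exists u, of_coords u == p1.
  rewrite /p1; apply: (big_ind (fun p => exists u, of_coords u == p)).
  - by exists 0; rewrite of_coords0.
  - move=> _ _ [u /eqP <-] [v /eqP <-]; exists (u + v); by rewrite of_coordsD.
  - move=> m _; exists [ffun b => if b == rem_mnm m then p@_m *: 'X_[quo_mnm m] else 0].
    by rewrite of_coords_delta comp_mpolyZ -scalerAl.
case: k IH pk => [_|k IH pk].
  by rewrite leqn0 msize_poly_eq0 => /eqP ->; exists 0; rewrite of_coords0.
have [|u2 /eqP u2E] := IH (p - p1).
  rewrite ltnS {1}[p]mpolyE /p1 -sumrB (leq_trans (mmeasure_sum _ _ _ _)) //.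
  rewrite big_seq; apply/bigmax_leqP_seq => m mp _; rewrite -scalerBr.
  rewrite (leq_trans (msizeZ_le _ _)) // -mmeasureN opprB (leq_trans (tm m)) //.
  by rewrite -ltnS (leq_trans _ pk) // msize_mdeg_lt.
by exists (u1 + u2); rewrite of_coordsD u1E u2E addrC subrK.
Qed.

Lemma seq_argmax (T : eqType) (f : T -> nat) (s : seq T) x :
  x \in s -> exists2 y, y \in s & forall z, z \in s -> (f z <= f y)%N.
Proof.
elim: s x => // a s IH x _; case: s IH => [_|b s /(_ b) IH].
  by exists a; rewrite ?mem_head // => z; rewrite inE => /eqP ->.
have [|y ys ymax] := IH; first exact: mem_head.
have [fya|/ltnW fay] := leqP (f y) (f a).
  exists a; first exact: mem_head.
  by move=> z; rewrite inE => /orP[/eqP -> //|/ymax /leq_trans ->].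
exists y; first by rewrite inE ys orbT.
by move=> z; rewrite inE => /orP[/eqP -> //|/ymax].
Qed.

(** Among the terms of [u], take one whose image has a leading monomial of maximal
    degree.  Distinct terms have distinct leading monomials, so its coefficient
    cannot be cancelled. *)
Lemma of_coords_eq0 u : of_coords u = 0 -> u = 0.
Proof.
move=> u0; apply/eqP/negPn/negP => nz.
pose S := [seq (b, m) | b <- enum [set: idx], m <- msupp (u b)].
have S_in b m : ((b, m) \in S) = (m \in msupp (u b)).
  apply/allpairsPdep/idP => [[b' [m' [_ h [-> ->]]]] //|h].
  by exists b, m; rewrite mem_enum inE.
have [[b1 m1]] : exists bm, bm \in S.
  have [b ub] : exists b, u b != 0.
    apply/existsP; rewrite -negb_forall; apply: contra nz => /forallP h.
    by apply/eqP/ffunP => b; rewrite ffunE; apply/eqP.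
  move: ub; rewrite -msupp_eq0; case e : (msupp (u b)) => [//|m s] _.
  by exists (b, m); rewrite S_in e mem_head.
pose f (bm : idx * 'X_{1..n}) := (bm.2 *+ N + reduced_mnm bm.1)%MM.
move=> /(seq_argmax (fun bm => mdeg (f bm)))[[b0 m0]].
rewrite S_in => m0S maxS; move/(congr1 (mcoeff (f (b0, m0)))): u0.
rewrite /of_coords mcoeff0 raddf_sum /=.
under eq_bigr => b _ do rewrite comp_mpolyEX mulr_suml raddf_sum /=.
have coef b m : m \in msupp (u b) ->
    ((u b)@_m *: ('X_[m] \mPo Pmap) * 'X_[reduced_mnm b])@_(f (b0, m0)) =
    (u b)@_m * ((b == b0) && (m == m0))%:R.
  move=> mb; rewrite -scalerAl mcoeffZ; congr (_ * _).
  have := lt_leadM (lt_lead_comp m) (lt_leadX (reduced_mnm b)).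
  rewrite /lt_lead => small.
  have : f (b0, m0) \notin msupp
      (('X_[m] \mPo Pmap) * 'X_[reduced_mnm b] - 'X_[(m *+ N + reduced_mnm b)]).
    apply: msize_mdeg_ge; apply: leq_trans small _.
    by apply: (maxS (b, m)); rewrite S_in.
  rewrite -mcoeff_eq0 mcoeffB subr_eq0 => /eqP ->.
  rewrite mcoeffX; congr (_%:R); congr (nat_of_bool _).
  apply/eqP/andP => [/quo_rem_inj [-> ->]|[/eqP -> /eqP ->]] //; by rewrite !eqxx.
rewrite (bigD1 b0) //= [X in _ + X]big1 ?addr0 => [|b bb0].
  rewrite (bigD1_seq m0) //= [X in _ + X]big_seq_cond [X in _ + X]big1 ?addr0.
    rewrite coef // !eqxx mulr1 => /eqP.
    by rewrite mcoeff_eq0 m0S.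
  by move=> m /andP[mb mm0]; rewrite coef // (negbTE mm0) andbF mulr0.
by rewrite big_seq big1 // => m mb; rewrite coef // (negbTE bb0) mulr0.
Qed.

Lemma of_coordsB u v : of_coords (u - v) = of_coords u - of_coords v.
Proof.
by rewrite /of_coords -sumrB; apply: eq_bigr => b _; rewrite !ffunE raddfB mulrBl.
Qed.

Lemma of_coords_inj : injective of_coords.
Proof.
by move=> u v uv; apply/subr0_eq/of_coords_eq0; rewrite of_coordsB uv subrr.
Qed.

Definition coords p := xchoose (of_coords_surj p).

Lemma coordsK : cancel coords of_coords.
Proof. by move=> p; apply/eqP/(xchooseP (of_coords_surj p)). Qed.

Opaque coords.

Lemma coordsD p q : coords (p + q) = coords p + coords q.
Proof. by apply: of_coords_inj; rewrite of_coordsD !coordsK. Qed.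

Lemma coords0 : coords 0 = 0.
Proof. by apply: of_coords_inj; rewrite of_coords0 coordsK. Qed.

Lemma coords_scale a p b : coords ((a \mPo Pmap) * p) b = a * coords p b.
Proof.
suff -> : coords ((a \mPo Pmap) * p) = [ffun b => a * coords p b] by rewrite ffunE.
by apply: of_coords_inj; rewrite of_coords_scale !coordsK.
Qed.

Lemma coords_mon b b' : coords 'X_[reduced_mnm b] b' = (b' == b)%:R.
Proof.
suff -> : coords 'X_[reduced_mnm b] = [ffun b' => if b' == b then 1 else 0].
  by rewrite ffunE; case: eqP.
by apply: of_coords_inj; rewrite of_coords_delta coordsK rmorph1 mul1r.
Qed.

(** Multiplication by [g] on C[z], as a matrix over C[y]. *)
Definition mulmat (g : {mpoly C[n]}) : 'M[{mpoly C[n]}]_#|{: idx}| :=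
  \matrix_(i, j) coords (g * 'X_[reduced_mnm (enum_val j)]) (enum_val i).

Lemma sum_enum_val (V : nmodType) (F : idx -> V) :
  \sum_(i < #|{: idx}|) F (enum_val i) = \sum_b F b.
Proof. by rewrite -big_enum_val. Qed.

Lemma mulmatD g h : mulmat (g + h) = mulmat g + mulmat h.
Proof.
apply/matrixP => i j; rewrite [LHS]mxE (mulrDl g h) coordsD ffunE [RHS]mxE.
by congr (_ + _); rewrite [RHS]mxE.
Qed.

(** Coordinates are C[y]-linear, so composing multiplications multiplies matrices. *)
Lemma mulmatM g h : mulmat (g * h) = mulmat g *m mulmat h.
Proof.
apply/matrixP => i j; rewrite !mxE.
under [RHS]eq_bigr => k _ do (rewrite 2!mxE [_ * coords _ _]mulrC -coords_scale).
rewrite (sum_enum_val (fun b => coords ((coords (h * 'X_[reduced_mnm (enum_val j)]) b \mPo Pmap) *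
  (g * 'X_[reduced_mnm b])) (enum_val i))).
rewrite -mulrA -[h * _ in LHS]coordsK /of_coords mulr_sumr.
rewrite (big_morph coords coordsD coords0) sum_ffunE.
by apply: eq_bigr => b _; rewrite mulrCA.
Qed.

Lemma mulmat_comp a : mulmat (a \mPo Pmap) = a%:M.
Proof.
apply/matrixP => i j; rewrite !mxE coords_scale coords_mon (inj_eq enum_val_inj).
by rewrite mulr_natr.
Qed.

Lemma mulmatC c : mulmat c%:MP = c%:MP%:M.
Proof. by rewrite -mulmat_comp comp_mpolyC. Qed.

(** The norm of C[z] over C[y]. *)
Definition fibre_norm g : {mpoly C[n]} := \det (mulmat g).

Section Fibre.
Variable w : 'I_n -> C.

Definition mulmat_at g : 'M[C]_#|{: idx}| := map_mx (meval w) (mulmat g).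

Lemma mulmat_atD g h : mulmat_at (g + h) = mulmat_at g + mulmat_at h.
Proof. by rewrite /mulmat_at mulmatD map_mxD. Qed.

Lemma mulmat_atM g h : mulmat_at (g * h) = mulmat_at g *m mulmat_at h.
Proof. by rewrite /mulmat_at mulmatM map_mxM. Qed.

Lemma mulmat_atC c : mulmat_at c%:MP = c%:M.
Proof. by rewrite /mulmat_at mulmatC map_scalar_mx /= mevalC. Qed.

Lemma mulmat_at_Pmap i : mulmat_at (tnth Pmap i) = (w i)%:M.
Proof.
have -> : tnth Pmap i = 'X_i \mPo Pmap by rewrite comp_mpolyXU -tnth_nth.
by rewrite /mulmat_at mulmat_comp map_scalar_mx /= mevalXU.
Qed.

Lemma fibre_normE g : (fibre_norm g).@[w] = \det (mulmat_at g).
Proof. by rewrite [RHS]det_map_mx. Qed.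

Definition in_fibre (z : 'I_n -> C) := forall i, (tnth Pmap i).@[z] = w i.

(** Evaluation at a point of the fibre is a linear form on the free module, hence a
    common left eigenvector of all the multiplications. *)
Lemma eigenvalue_fibre g z : in_fibre z -> eigenvalue (mulmat_at g) g.@[z].
Proof.
move=> zw; apply/eigenvalueP.
exists (\row_j ('X_[reduced_mnm (enum_val j)]).@[z]).
  apply/rowP => j; rewrite !mxE -mevalM -[g * _ in RHS]coordsK /of_coords raddf_sum /=.
  rewrite -(sum_enum_val (fun b => meval z ((coords (g * 'X_[reduced_mnm (enum_val j)])
    b \mPo Pmap) * 'X_[reduced_mnm b]))).
  apply: eq_bigr => k _; rewrite !mxE mevalM mulrC; congr (_ * _).
  by rewrite comp_mpoly_meval; apply: meval_eq.
apply/negP => /eqP/rowP /(_ (enum_rank (rem_mnm 0%MM))); rewrite !mxE enum_rankK.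
have -> : reduced_mnm (rem_mnm 0%MM) = 0%MM by apply/mnmP => i; rewrite mnmE ffunE /= !mnmE mod0n.
by rewrite mpolyX0 meval1 => /eqP; rewrite oner_eq0.
Qed.

(** Commuting matrices stabilise the eigenspaces of one another, so the common
    eigenvector can be found inside a prescribed eigenspace. *)
Lemma common_eigenvector_in (d : nat) (A : 'M[C]_d) (As : seq 'M[C]_d) t :
  eigenvalue A t -> {in A :: As &, forall A B, comm_mx A B} ->
  exists2 v : 'rV_d, v != 0 & v *m A = t *: v /\ {in As, forall B, stablemx v B}.
Proof.
move=> At comm; pose E := eigenspace A t.
have stabE B : B \in As -> stablemx E B.
  move=> BAs; apply: comm_mx_stable_eigenspace.
  by apply: comm; rewrite inE ?eqxx // BAs orbT.
have [] := @common_eigenvector C _ [seq restrictmx E B | B <- As].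
- by rewrite lt0n mxrank_eq0.
- move=> _ _ /mapP[B BAs ->] /mapP[B' B'As ->].
  rewrite /comm_mx -!conjmxM ?inE ?stablemx_row_base ?stabE //.
  by congr (conjmx _ _); apply: comm; rewrite inE ?BAs ?B'As orbT.
move=> v v0 /allP vP; exists (v *m row_base E).
  by rewrite mulmx_free_eq0 ?row_base_free.
split; first by apply/eigenspaceP; rewrite mulmx_sub // eq_row_base.
move=> B BAs; rewrite -stablemx_restrict ?stabE //.
by apply: vP; apply/mapP; exists B.
Qed.

Lemma mulmat_at_comm g h : comm_mx (mulmat_at g) (mulmat_at h).
Proof. exact: etrans (esym (mulmat_atM g h)) (etrans (congr1 mulmat_at (mulrC g h))
  (mulmat_atM h g)). Qed.

(** Conversely a common left eigenvector in the [t]-eigenspace of [g] is, up to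
    scaling, evaluation at the point whose coordinates are the eigenvalues of the
    multiplications by the variables: this is the Nullstellensatz for the fibre. *)
Lemma fibre_eigenvalue g t : eigenvalue (mulmat_at g) t ->
  exists2 z, in_fibre z & g.@[z] = t.
Proof.
move=> gt; pose As := [seq mulmat_at 'X_i | i <- enum 'I_n].
have [|v v0 [vg vAs]] := common_eigenvector_in (As := As) gt.
  move=> A B AAs BAs.
  have isM D : D \in mulmat_at g :: As -> exists h, D = mulmat_at h.
    rewrite inE => /orP[/eqP ->|/mapP[i _ ->]]; first by exists g.
    by exists 'X_i.
  have [[h ->] [h' ->]] := (isM A AAs, isM B BAs).
  exact: mulmat_at_comm.
have /fin_all_exists[z zE] i : exists a, v *m mulmat_at 'X_i = a *: v.
  have /sub_rVP[a ->] : stablemx v (mulmat_at 'X_i).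
    by apply: vAs; apply/mapP; exists i; rewrite ?mem_enum.
  by exists a.
have vE h : v *m mulmat_at h = h.@[z] *: v.
  elim/mpoly_ring_ind: h => [c|i|h1 h2 e1 e2|h1 h2 e1 e2].
  - by rewrite mulmat_atC mul_mx_scalar mevalC.
  - by rewrite zE mevalXU.
  - by rewrite mulmat_atD mulmxDr mevalD scalerDl; congr (_ + _).
  - by rewrite mulmat_atM mulmxA e1 -scalemxAl e2 scalerA mevalM.
have v_inj a b : a *: v = b *: v -> a = b.
  by move/eqP; rewrite -subr_eq0 -scalerBl scaler_eq0 (negbTE v0) orbF subr_eq0 => /eqP.
exists z; last by apply: v_inj; rewrite -vE.
by move=> i; apply: v_inj; rewrite -vE mulmat_at_Pmap mul_mx_scalar.
Qed.

Lemma fibre_norm_eq0 g z : in_fibre z -> g.@[z] = 0 -> (fibre_norm g).@[w] = 0.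
Proof.
move=> zw gz; rewrite fibre_normE; have := eigenvalue_fibre g zw; rewrite gz eigenvalue_root_char.
rewrite /root horner_coef0 char_poly_det mulf_eq0 signr_eq0 /=.
by move/eqP.
Qed.

(** The determinant is the product of the eigenvalues, which are values of [g] on the
    fibre: if all were at least [c], the product would be too large. *)
Lemma fibre_norm_small g c : 0 < c -> `|(fibre_norm g).@[w]| < c ^+ #|{: idx}| ->
  exists2 z, in_fibre z & `|g.@[z]| < c.
Proof.
rewrite fibre_normE => c0 small; set A := mulmat_at g in small *.
have [s sE] := closed_field_poly_normal (char_poly A).
move: sE; rewrite (monicP (char_poly_monic A)) scale1r => sE.
have sz : size s = #|{: idx}|.
  by have := size_char_poly A; rewrite sE size_prod_XsubC => -[].
have /hasP[t ts tc] : has (fun t => `|t| < c) s.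
  apply: contraLR small; rewrite -all_predC => /allP /= h.
  rewrite -real_leNgt ?normr_real ?realX ?gtr0_real //.
  have -> : `|\det A| = \prod_(t <- s) `|t|.
    have := char_poly_det A; rewrite sE -horner_coef0 horner_prod.
    move/(congr1 Num.norm); rewrite normrM normrX normrN1 expr1n mul1r normr_prod => <-.
    by apply: eq_bigr => t _; rewrite hornerXsubC sub0r normrN.
  have <- : \prod_(t <- s) c = c ^+ #|{: idx}|.
    by rewrite big_const_seq count_predT iter_mulr_1 sz.
  rewrite big_seq [leRHS]big_seq.
  apply: ler_prod => t ts; rewrite ltW //=.
  by have := h t ts; rewrite -real_leNgt ?normr_real ?gtr0_real.
have [|z zw gz] := @fibre_eigenvalue g t.
  by rewrite eigenvalue_root_char sE root_prod_XsubC.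
by exists z; rewrite ?gz.
Qed.

(** The coordinates of the points of a fibre are roots of characteristic polynomials.
    Removing the root z0_i from the i-th one and multiplying gives a polynomial which
    is nonzero at [z0] and vanishes on the rest of the fibre; subtract its value. *)
Lemma separate_fibre z0 : in_fibre z0 ->
  exists2 g : {mpoly C[n]}, g.@[z0] = 0 & forall z, in_fibre z -> g.@[z] = 0 -> z =1 z0.
Proof.
move=> z0w.
have /fin_all_exists[q qP] i : exists q : {poly C}, q.[z0 i] != 0 /\
    forall z, in_fibre z -> z i != z0 i -> q.[z i] = 0.
  (* [q] is the characteristic polynomial deprived of the root z0_i *)
  have [m [q ]] := multiplicity_XsubC (char_poly (mulmat_at 'X_i)) (z0 i).
  have nz := monic_neq0 (char_poly_monic (mulmat_at 'X_i)).
  rewrite nz /= => qz0 qE; exists q; split=> // z zw zz0.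
  have := eigenvalue_fibre 'X_i zw; rewrite mevalXU eigenvalue_root_char qE.
  rewrite rootM => /orP[/rootP //|].
  rewrite /root horner_exp hornerXsubC expf_eq0 subr_eq0 (negbTE zz0).
  by rewrite andbF.
pose h : {mpoly C[n]} := \prod_i (map_poly (@mpolyC n C) (q i)).['X_i].
have hE z : h.@[z] = \prod_i (q i).[z i].
  rewrite rmorph_prod; apply: eq_bigr => i _ /=.
  rewrite -horner_map /= mevalXU -map_poly_comp /=; congr (_.[_]).
  by rewrite map_poly_id // => c _ /=; rewrite mevalC.
exists (h - (h.@[z0])%:MP); first by rewrite mevalB mevalC subrr.
move=> z zw /eqP; rewrite mevalB mevalC subr_eq0 !hE => /eqP e i.
apply/eqP/negPn/negP => zi; move/eqP: e; apply/negP.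
rewrite (bigD1 i) //= (qP i).2 // mul0r eq_sym; apply/prodf_neq0 => j _.
exact: (qP j).1.
Qed.

End Fibre.
End FiniteMap.
End FiniteMap.

(** * Topology of complex space *)

From mathcomp Require Import all_classical all_reals all_analysis.
Import numFieldNormedType.Exports.
Local Open Scope classical_set_scope.
Local Open Scope ring_scope.

Lemma near_dist_lt (K : numFieldType) (V : normedModType K) (x : V) (e : K) :
  0 < e -> \forall y \near x, `|x - y| < e.
Proof. by move=> e0; exact: (@cvgr_dist_lt _ _ _ (nbhs x) _ id x). Qed.

Lemma dist_continuous (T : topologicalType) (K : numFieldType) (V : normedModType K)
    (f : T -> V) x : (forall e, 0 < e -> \forall y \near x, `|f x - f y| < e) ->
  {for x, continuous f}.
Proof. by move=> h; exact/(@cvgrPdist_lt _ _ _ (nbhs x)). Qed.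

Lemma continuous_dist (T : topologicalType) (K : numFieldType) (V : normedModType K)
    (f : T -> V) x e : {for x, continuous f} -> 0 < e ->
  \forall y \near x, `|f x - f y| < e.
Proof. by move=> fx e0; exact: (@cvgr_dist_lt _ _ _ (nbhs x) _ f). Qed.

Section ComplexTopology.
Variable R : realType.
Local Notation C := R[i].
Implicit Types z w : C.

Lemma normc_i : `|'i%C| = 1 :> C.
Proof. by rewrite normc_def /= expr0n expr1n add0r sqrtr1. Qed.

Lemma normc_real_complex (x : R) : `|x%:C%C| = `|x|%:C%C.
Proof. by rewrite normc_def /= expr0n addr0 sqrtr_sqr. Qed.

Lemma normc_ReIm z : `|z| <= (`|complex.Re z| + `|complex.Im z|)%:C%C.
Proof.
rewrite [z in `|z|]complexE rmorphD (le_trans (ler_normD _ _)) //.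
by rewrite normrM !normc_real_complex normc_i mul1r.
Qed.

Lemma normc_Re z : (`|complex.Re z|)%:C%C <= `|z|.
Proof.
by rewrite normc_def lecR -sqrtr_sqr ler_wsqrtr // lerDl sqr_ge0.
Qed.

Lemma normc_Im z : (`|complex.Im z|)%:C%C <= `|z|.
Proof.
by rewrite normc_def lecR -sqrtr_sqr ler_wsqrtr // lerDr sqr_ge0.
Qed.

Lemma gt0_realP (e : C) : 0 < e -> exists2 r : R, 0 < r & e = r%:C%C.
Proof. by case: e => a b; rewrite ltcE /= => /andP[/eqP -> a0]; exists a. Qed.

Lemma continuous_Re : continuous (@complex.Re R : C -> R).
Proof.
move=> z; apply: dist_continuous => e e0.
have e0' : 0 < e%:C%C :> C by rewrite ltcR.
apply: filterS (near_dist_lt z e0') => w.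
by rewrite -raddfB -ltcR; apply: le_lt_trans (normc_Re _).
Qed.

Lemma continuous_Im : continuous (@complex.Im R : C -> R).
Proof.
move=> z; apply: dist_continuous => e e0.
have e0' : 0 < e%:C%C :> C by rewrite ltcR.
apply: filterS (near_dist_lt z e0') => w.
by rewrite -raddfB -ltcR; apply: le_lt_trans (normc_Im _).
Qed.

Lemma continuous_real_complex : continuous (fun t : R => t%:C%C : C).
Proof.
move=> t; apply: dist_continuous => e /gt0_realP[r r0 ->].
apply: filterS (near_dist_lt (t : R^o) r0) => s.
by rewrite -rmorphB normc_real_complex ltcR.
Qed.

Lemma continuous_pair_complex : continuous (fun p : R * R => Complex p.1 p.2 : C).
Proof.
move=> -[a b]; apply: dist_continuous => e /gt0_realP[r r0 ->].
have r20 : 0 < r / 2 by rewrite divr_gt0.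
exists (ball a (r / 2), ball b (r / 2)); first by split; exact: nbhsx_ballx.
move=> [x y] [/= xa yb]; apply: (le_lt_trans (normc_ReIm _)).
by rewrite ltcR /= [ltRHS]splitr ltrD.
Qed.

(** Squares rather than discs: their compactness is immediate, and they fit the square
    contours used below. *)
Definition cbox (a : R) : set C := [set z | `|complex.Re z| <= a /\ `|complex.Im z| <= a].

Lemma compact_cbox a : compact (cbox a).
Proof.
suff -> : cbox a = (fun p : R * R => Complex p.1 p.2 : C) @` (`[-a, a] `*` `[-a, a]).
  apply: continuous_compact; last by apply: compact_setX; exact: segment_compact.
  exact/continuous_subspaceT/continuous_pair_complex.
apply/seteqP; split=> [[x y] [/= xa ya]|_ [[x y] [/= xa ya] <-]].
  by exists (x, y) => //; split; rewrite /= in_itv /= -ler_norml.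
by split; move: xa ya; rewrite /= !in_itv /= -!ler_norml.
Qed.

Definition polybox n (a : R) : set 'rV[C]_n := [set v | forall i, cbox a (v ord0 i)].

Lemma compact_polybox n a : compact (@polybox n a).
Proof. by apply: (@rV_compact C n (fun=> cbox a)) => i; exact: compact_cbox. Qed.

Lemma coord_norm_le n (v : 'rV[C]_n) i : `|v ord0 i| <= `|v|.
Proof.
rewrite [`|v|]/Num.norm /= mx_normE -[leLHS]nngE num_le.
exact: (le_bigmax _ (fun ij : 'I_1 * 'I_n => `|v ij.1 ij.2|%:nng) (ord0, i)).
Qed.

Lemma polybox_norm n (v : 'rV[C]_n) (b : R) : `|v| <= b%:C%C -> polybox b v.
Proof.
move=> vb i; have {}vb := le_trans (coord_norm_le v i) vb.
by split; rewrite -lecR; [apply: le_trans (normc_Re _) vb | apply: le_trans (normc_Im _) vb].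
Qed.

Lemma norm_rV_le n (v : 'rV[C]_n) (c : C) : 0 <= c -> (forall i, `|v ord0 i| <= c) -> `|v| <= c.
Proof.
move=> c0 vc; rewrite -[`|v|]/(mx_norm v).
have [->//|/mx_norm_neq0[[i j] /= ->]] := eqVneq (mx_norm v) 0.
by rewrite ord1.
Qed.

Section ComplexContinuity.
Variables (T : topologicalType) (x : T).
Implicit Types f g : T -> C.

Lemma continuous_atD f g : {for x, continuous f} -> {for x, continuous g} ->
  {for x, continuous (fun y => f y + g y)}.
Proof. exact: (@cvgD C C T (nbhs x) _ f g). Qed.

Lemma continuous_atB f g : {for x, continuous f} -> {for x, continuous g} ->
  {for x, continuous (fun y => f y - g y)}.
Proof. exact: (@cvgB C C T (nbhs x) _ f g). Qed.

Lemma continuous_atM f g : {for x, continuous f} -> {for x, continuous g} ->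
  {for x, continuous (fun y => f y * g y)}.
Proof. exact: (@cvgM C T (nbhs x) _ f g). Qed.

Lemma continuous_atV f : f x != 0 -> {for x, continuous f} ->
  {for x, continuous (fun y => (f y)^-1)}.
Proof. move=> fx0; exact: (@cvgV C T (nbhs x) _ f _ fx0). Qed.

Lemma continuous_at_cst (c : C) : {for x, continuous (fun _ : T => c)}.
Proof. exact: cst_continuous. Qed.

Lemma continuous_at_rV n (f : T -> 'rV[C]_n) :
  (forall i, {for x, continuous (fun y => f y ord0 i)}) -> {for x, continuous f}.
Proof.
move=> fi; apply: dist_continuous => e e0.
have e20 : 0 < e / 2 by rewrite divr_gt0.
have : \forall y \near x, forall i, `|f x ord0 i - f y ord0 i| < e / 2.
  by apply: filter_forall => i; apply: continuous_dist (fi i) e20.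
apply: filterS => y fy; apply: (@le_lt_trans _ _ (e / 2)).
  by apply: norm_rV_le => [|i]; rewrite ?ltW // !mxE fy.
by rewrite gtr_pMr // invf_lt1 // ltr1n.
Qed.

End ComplexContinuity.

Lemma continuous_at_coord n (v : 'rV[C]_n) i : {for v, continuous (fun u :
  'rV[C]_n => u ord0 i : C)}.
Proof. exact: coord_continuous. Qed.

Lemma continuous_meval n (p : mpoly.mpoly n C) :
  continuous (fun v : 'rV[C]_n => mpoly.meval (v ord0) p : C).
Proof.
move=> v; elim/FiniteMap.mpoly_ring_ind: p => [c|i|p q cp cq|p q cp cq].
- under eq_fun => u do rewrite mpoly.mevalC.
  exact: continuous_at_cst.
- under eq_fun => u do rewrite mpoly.mevalXU.
  exact: continuous_at_coord.
- under eq_fun => u do rewrite mpoly.mevalD.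
  exact: (continuous_atD cp cq).
- under eq_fun => u do rewrite mpoly.mevalM.
  exact: (continuous_atM cp cq).
Qed.

End ComplexTopology.

(** * Openness of finite polynomial maps *)

Section OpenMap.
Variables (R : realType) (n N : nat).
Local Notation C := R[i].
Variable Q : 'I_n -> mpoly.mpoly n C.

Definition polymap (z : 'rV[C]_n) : 'rV[C]_n :=
  \row_i (z ord0 i ^+ N + mpoly.meval (z ord0) (Q i)).

Lemma polymap_fibre w z :
  FiniteMap.in_fibre N Q w z <-> forall i, polymap (\row_j z j) ord0 i = w i.
Proof.
split=> h i; rewrite -h ?mxE FiniteMap.meval_Pmap //.
- by congr (_ + _); apply: mpoly.meval_eq => j; rewrite mxE.
- by congr (_ + _); apply: mpoly.meval_eq => j; rewrite mxE.
Qed.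

Lemma polymap_continuous : continuous polymap.
Proof.
move=> z; apply: continuous_at_rV => i.
have -> : (fun y => polymap y ord0 i) = (fun y :
  'rV[C]_n => mpoly.meval (y ord0) (tnth (FiniteMap.Pmap N Q) i)).
  by apply/funext => y; rewrite mxE FiniteMap.meval_Pmap.
exact: continuous_meval.
Qed.

Hypothesis N_gt0 : (0 < N)%N.
Hypothesis degQ : forall i, FiniteMap.deg_lt N (Q i).

(** If |z| > 1 is attained at the j-th coordinate, then |z|^N is at most
    |F_j(z)| + |Q_j(z)|, hence at most (b + A) |z|^(N-1). *)
Lemma polymap_proper (b : C) : 0 <= b -> exists c : R, forall z, `|polymap z| <= b ->
  `|z| <= c%:C%C.
Proof.
move=> b0.
pose A : C := \sum_i \sum_(m <- mpoly.msupp (Q i)) `|mpoly.mcoeff m (Q i)|.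
have A0 : 0 <= A by apply: sumr_ge0 => i _; apply: sumr_ge0.
exists (complex.Re (1 + b + A)) => z zb.
have -> : (complex.Re (1 + b + A))%:C%C = 1 + b + A.
  by rewrite RRe_real // ger0_real // !addr_ge0.
have [z1|z1] := real_leP (normr_real z) (real1 _).
  by rewrite (le_trans z1) // -addrA lerDl addr_ge0.
have [z0|/mx_norm_neq0[[i j] /= zi]] := eqVneq (mx_norm z) 0.
  by move: z1; rewrite -[`|z|]/(mx_norm z) z0 ltr10.
rewrite ord1 in zi; have {}zi : `|z| = `|z ord0 j| by [].
suff : `|z| <= b + A by move=> /le_trans -> //; rewrite lerD2r lerDr.
rewrite -(ler_pM2r (exprn_gt0 N.-1 (lt_trans ltr01 z1))) -exprS prednK //.
have -> : `|z| ^+ N = `|polymap z ord0 j - mpoly.meval (z ord0) (Q j)|.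
  by rewrite mxE addrK normrX zi.
apply: le_trans (ler_normB _ _) _; rewrite mulrDl lerD //.
  apply: le_trans (coord_norm_le _ _) _; apply: le_trans zb _.
  by rewrite ler_peMr // exprn_ege1 // ltW.
apply: le_trans (FiniteMap.meval_le (N := N.-1) (b := `|z|) _ _ _) _.
- by rewrite prednK.
- exact: ltW.
- by move=> k; exact: coord_norm_le.
rewrite ler_wpM2r ?exprn_ge0 // /A (bigD1 j) //= lerDl sumr_ge0 // => k _.
exact: sumr_ge0.
Qed.

(** [g] separates [z0] from the other points of its fibre.  On the compact set [K] of
    candidates outside the neighbourhood [U], a point of a fibre close to that of
    [z0] has |g| >= eps k for some fixed k; but the norm of [g] vanishes at [w0], so
    each nearby fibre has a point with |g| < eps k, which must then be in [U]. *)
Lemma polymap_open (z0 : 'rV[C]_n) (O : set 'rV[C]_n) : nbhs z0 O ->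
  \forall w \near polymap z0, exists2 z, O z & polymap z = w.
Proof.
rewrite nbhsE => -[U [Uo Uz0] UO]; set w0 := polymap z0.
have z0w : FiniteMap.in_fibre N Q (w0 ord0) (z0 ord0).
  by apply/polymap_fibre => i; congr ((polymap _) _ _); apply/rowP => j; rewrite mxE.
have [g g0 gz] := FiniteMap.separate_fibre N_gt0 degQ z0w.
pose D (w : 'rV[C]_n) := mpoly.meval (w ord0) (FiniteMap.fibre_norm N_gt0 degQ g).
pose d := #|{: {ffun 'I_n -> 'I_N}}|.
have D0 : D w0 = 0.
  by rewrite /D (FiniteMap.fibre_norm_eq0 _ _ z0w).
have [c hc] := polymap_proper (b := `|w0| + 1) (addr_ge0 (normr_ge0 _) ler01).
pose K := polybox c `&` ~` U.
have Kc : compact K.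
  by apply: compact_closedI; [exact: compact_polybox | exact: open_closedC].
pose eps (k : nat) : C := (k.+1%:R^-1 : R)%:C%C.
have eps_lt (e : C) : 0 < e -> \forall k \near \oo, eps k < e.
  move=> /gt0_realP[r r0 ->]; have := near_infty_natSinv_lt (PosNum r0).
  by apply: filterS => k; rewrite /eps ltcR.
have [|[A B] /= [Aw0 Boo] AB] := (compact_near_coveringP K).1 Kc _ (filter_prod (nbhs w0) \oo)
  (fun wk z => polymap z = wk.1 -> eps wk.2 <= `|mpoly.meval (z ord0) g|) _.
  move=> z [_ Uz].
  have [zw|zw] := eqVneq (polymap z) w0.
    have gz0 : mpoly.meval (z ord0) g != 0.
      apply/eqP => gz0; apply: Uz; suff -> : z = z0 by [].
      apply/rowP => i; apply: (gz (z ord0)) => //; apply/polymap_fibre => j.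
      by rewrite -zw; congr (polymap _ _ _); apply/rowP => k; rewrite mxE.
    have e0 : 0 < `|mpoly.meval (z ord0) g| / 2 by rewrite divr_gt0 ?normr_gt0.
    exists ([set z' : 'rV[C]_n | `|mpoly.meval (z ord0) g - mpoly.meval (z' ord0)
      g| < `|mpoly.meval (z ord0) g| / 2],
      [set wk : 'rV[C]_n * nat | eps wk.2 < `|mpoly.meval (z ord0) g| / 2]).
      split; first exact: (continuous_dist (@continuous_meval _ _ g z) e0).
      exists (setT, [set k | eps k < `|mpoly.meval (z ord0) g| / 2]).
        by split; [exact: filterT | exact: eps_lt].
      by move=> [w k] [].
    move=> [z' [w k]] [/= dz ek] _; apply: (le_trans (ltW ek)).
    rewrite -(lerD2l (`|mpoly.meval (z ord0) g| / 2)) -splitr.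
    rewrite -{1}[mpoly.meval (z ord0) g](subrK (mpoly.meval (z' ord0) g)).
    by rewrite (le_trans (ler_normD _ _)) // lerD2r ltW.
  have e0 : 0 < `|polymap z - w0| / 2 by rewrite divr_gt0 ?normr_gt0 ?subr_eq0.
  exists ([set z' : 'rV[C]_n | `|polymap z - polymap z'| < `|polymap z - w0| / 2],
     [set wk : 'rV[C]_n * nat | `|w0 - wk.1| < `|polymap z - w0| / 2]).
    split; first exact: (continuous_dist (@polymap_continuous z) e0).
    exists ([set w : 'rV[C]_n | `|w0 - w| < `|polymap z - w0| / 2], setT).
      by split; [exact: (@near_dist_lt C 'rV[C]_n w0 _ e0) | exact: filterT].
    by move=> [w k] [].
  move=> [z' [w k]] [/= dz dw] zw'; have := ltrD dz dw.
  rewrite -splitr zw' => h; exfalso; move: h; apply/negP.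
  rewrite -real_leNgt ?realD ?normr_real // (distrC w0).
  by apply: le_trans (ler_normD _ _); rewrite addrA subrK.
have [k Bk] : exists k, B k by case: Boo => k _ kB; exists k; apply: kB => /=.
have epsk0 : 0 < eps k by rewrite /eps ltcR invr_gt0.
near=> w.
have [|z zw gze] := FiniteMap.fibre_norm_small (N_gt0 := N_gt0) (degQ := degQ)
    (g := g) (w := w ord0) (c := eps k) epsk0.
  suff : `|D w0 - D w| < eps k ^+ d by rewrite D0 sub0r normrN.
  near: w; apply: (@continuous_dist 'rV[C]_n C C D w0).
    exact: continuous_meval.
  exact: exprn_gt0.
have zw' : polymap (\row_j z j) = w by apply/rowP => i; apply/polymap_fibre: i.
exists (\row_j z j) => //; apply: UO; apply: contrapT => zU.
have gzr : mpoly.meval ((\row_j z j) ord0) g = mpoly.meval z g.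
  by apply: mpoly.meval_eq => i; rewrite mxE.
have Aw : A w by near: w.
have Kz : K (\row_j z j).
  split=> //; apply/polybox_norm/hc; rewrite zw'.
  have ww0 : `|w0 - w| < 1 by near: w; exact: (@near_dist_lt C 'rV[C]_n w0 1 ltr01).
  have -> : w = w0 - (w0 - w) by rewrite opprB addrC subrK.
  by rewrite (le_trans (ler_normB _ _)) // lerD2l ltW.
have := AB (w, k) (conj Aw Bk) _ Kz zw'.
rewrite /= gzr => h; have := le_lt_trans h gze; by rewrite ltxx.
Unshelve. all: by end_near. Qed.

End OpenMap.

(** * Midpoint sums and Goursat's lemma *)

Section MidpointSums.
Variable R : realType.
Local Notation C := R[i].
Implicit Types (F G : C -> C) (a d c h : C) (M : nat).

(** The midpoint sum of F(z) dz along the segment from [a] to [a + d], cut into 2^M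
    equal pieces.  Recursive halving makes additivity under subdivision definitional. *)
Fixpoint midsum F M a d : C :=
  if M is M'.+1 then midsum F M' a (d / 2) + midsum F M' (a + d / 2) (d / 2)
  else d * F (a + d / 2).

Lemma midsumB F G M a d : midsum (fun z => F z - G z) M a d = midsum F M a d - midsum G M a d.
Proof.
elim: M a d => [|M IH] a d /=; first by rewrite mulrBr.
by rewrite !IH; ring.
Qed.

Lemma midsumZ (k : C) F M a d : midsum (fun z => k * F z) M a d = k * midsum F M a d.
Proof.
elim: M a d => [|M IH] a d /=; first by rewrite mulrCA.
by rewrite !IH; ring.
Qed.

(** This exactness lets Goursat's argument subtract the affine part of the function. *)
Lemma midsum_affine p q M a d : midsum (fun z => p + q * z) M a d = d * (p + q * (a + d / 2)).
Proof.
elim: M a d => [//|M IH] a d /=.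
by rewrite !IH; field.
Qed.

Definition on_segment (a d : C) : set C := [set z | exists2 t :
  R, 0 <= t <= 1 & z = a + t%:C%C * d].

Lemma on_segment_l a d : on_segment a (d / 2) `<=` on_segment a d.
Proof.
move=> _ [t /andP[t0 t1] ->]; exists (t / 2); first by apply/andP; split; lra.
by rewrite rmorphM fmorphV /= rmorph_nat; ring.
Qed.

Lemma on_segment_r a d : on_segment (a + d / 2) (d / 2) `<=` on_segment a d.
Proof.
move=> _ [t /andP[t0 t1] ->]; exists ((t + 1) / 2); first by apply/andP; split; lra.
by rewrite rmorphM rmorphD fmorphV /= rmorph1 rmorph_nat; field.
Qed.

Lemma on_segment_mid a d : on_segment a d (a + d / 2).
Proof.
exists (1 / 2); first by apply/andP; split; lra.
by rewrite rmorphM fmorphV /= rmorph1 rmorph_nat; field.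
Qed.

Lemma eq_midsum F G M a d : {in on_segment a d, F =1 G} -> midsum F M a d = midsum G M a d.
Proof.
elim: M a d => [|M IH] a d /= FG; first by rewrite FG // inE; exact: on_segment_mid.
congr (_ + _); apply: IH => z; rewrite inE => zs; apply: FG; rewrite inE.
- exact: on_segment_l.
- exact: on_segment_r.
Qed.

Lemma midsum_near F (u e : C) M a d : (forall z, on_segment a d z -> `|F z - u| <= e) ->
  `|midsum F M a d - d * u| <= `|d| * e.
Proof.
elim: M a d => [|M IH] a d /= Fu.
  by rewrite -mulrBr normrM ler_wpM2l // Fu //; exact: on_segment_mid.
set x := midsum F M a _; set y := midsum F M _ _.
have -> : x + y - d * u = (x - d / 2 * u) + (y - d / 2 * u) by field.
have -> : `|d| * e = `|d / 2| * e + `|d / 2| * e.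
  by rewrite -mulrDl normrM normfV normr_nat -splitr.
rewrite (le_trans (ler_normD _ _)) //.
by rewrite lerD // IH // => z zs; apply: Fu; [exact: on_segment_l|exact: on_segment_r].
Qed.

Lemma midsum_le F (e : C) M a d : (forall z, on_segment a d z -> `|F z| <= e) ->
  `|midsum F M a d| <= `|d| * e.
Proof.
move=> Fe; have := @midsum_near F 0 e M a d; rewrite mulr0 subr0; apply=> z zs.
by rewrite subr0 Fe.
Qed.

(** The counterclockwise contour sum over the square with lower left corner [c] and
    side [h]; the upper and left sides are described forwards and subtracted. *)
Definition sqsum F M c h : C :=
  midsum F M c h + midsum F M (c + h) ('i%C * h)
  - midsum F M (c + 'i%C * h) h - midsum F M c ('i%C * h).

(** The sums along the inner sides cancel exactly. *)
Lemma sqsum_double F M c k : sqsum F M.+1 c (k + k) =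
  sqsum F M c k + sqsum F M (c + k) k
  + sqsum F M (c + 'i%C * k) k + sqsum F M (c + k + 'i%C * k) k.
Proof.
rewrite /sqsum /=.
have -> : (k + k) / 2 = k by field.
have -> : 'i%C * (k + k) / 2 = 'i%C * k by field.
rewrite !mulrDr !addrA.
have -> : c + 'i%C * k + k = c + k + 'i%C * k by ring.
have -> : c + 'i%C * k + 'i%C * k + k = c + k + 'i%C * k + 'i%C * k by ring.
have -> : c + k + 'i%C * k + k = c + k + k + 'i%C * k by ring.
ring.
Qed.

Lemma sqsum_affine p q M c h : sqsum (fun z => p + q * z) M c h = 0.
Proof. by rewrite /sqsum !midsum_affine; field. Qed.

Lemma sqsumB F G M c h : sqsum (fun z => F z - G z) M c h = sqsum F M c h - sqsum G M c h.
Proof. by rewrite /sqsum !midsumB; ring. Qed.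

Lemma sqsumZ (k : C) F M c h : sqsum (fun z => k * F z) M c h = k * sqsum F M c h.
Proof. by rewrite /sqsum !midsumZ; ring. Qed.

Definition square_bd (c h : C) : set C := on_segment c h `|` on_segment (c + h) ('i%C * h)
  `|` on_segment (c + 'i%C * h) h `|` on_segment c ('i%C * h).

Lemma eq_sqsum F G M c h : {in square_bd c h, F =1 G} -> sqsum F M c h = sqsum G M c h.
Proof.
move=> FG; rewrite /sqsum; congr (_ + _ - _ - _); apply: eq_midsum => z zs; apply: FG;
  move: zs; rewrite !inE /square_bd /=; tauto.
Qed.

Lemma sqsum_le F (e : C) M c h : (forall z, square_bd c h z -> `|F z| <= e) ->
  `|sqsum F M c h| <= 4 * `|h| * e.
Proof.
move=> Fe.
have ih : `|'i%C * h| = `|h| by rewrite normrM normc_i mul1r.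
have h1 : `|midsum F M c h| <= `|h| * e by apply: midsum_le => z zs; apply: Fe;
  rewrite /square_bd/=; tauto.
have h2 : `|midsum F M (c + h) ('i%C * h)| <= `|h| * e.
  by rewrite -ih; apply: midsum_le => z zs; apply: Fe; rewrite /square_bd/=; tauto.
have h3 : `|midsum F M (c + 'i%C * h) h| <= `|h| * e by apply: midsum_le => z zs; apply: Fe;
  rewrite /square_bd/=; tauto.
have h4 : `|midsum F M c ('i%C * h)| <= `|h| * e.
  by rewrite -ih; apply: midsum_le => z zs; apply: Fe; rewrite /square_bd/=; tauto.
have -> : 4 * `|h| * e = `|h| * e + `|h| * e + `|h| * e + `|h| * e by ring.
rewrite /sqsum (le_trans (ler_normB _ _)) // lerD // (le_trans (ler_normB _ _)) // lerD //.
by rewrite (le_trans (ler_normD _ _)) // lerD.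
Qed.

End MidpointSums.

Section Goursat.
Variable R : realType.
Local Notation C := R[i].

Lemma nested_point (u h : nat -> R) : (forall n, 0 <= h n) ->
  (forall n, u n <= u n.+1 /\ u n.+1 + h n.+1 <= u n + h n) ->
  exists s, forall n, u n <= s <= u n + h n.
Proof.
move=> h0 uh.
have um m n : (m <= n)%N -> u m <= u n /\ u n + h n <= u m + h m.
  elim: n => [|n IH]; first by rewrite leqn0 => /eqP ->.
  rewrite leq_eqVlt => /orP[/eqP -> //|]; rewrite ltnS => /IH[a b].
  by have [c d] := uh n; split; [exact: le_trans c | exact: le_trans b].
have uu m n : u n <= u m + h m.
  have [mn|/ltnW nm] := leqP m n.
    by have [_] := um _ _ mn; apply: le_trans; rewrite lerDl.
  by have [a _] := um _ _ nm; rewrite (le_trans a) // lerDl.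
exists (sup (range u)) => n; apply/andP; split.
  apply: ub_le_sup; last by exists n.
  by exists (u 0%N + h 0%N) => _ [m _ <-].
by apply: ge_sup; [exists (u 0%N), 0%N | move=> _ [m _ <-]].
Qed.

(** Cousin's lemma for squares: a property that passes from the four quarters to a
    square and holds for all small squares around each point holds everywhere.
    Otherwise repeated bisection yields nested bad squares shrinking to a point. *)
Lemma square_induction (G : R -> R -> R -> Prop) x y h : 0 < h ->
  (forall x y k, 0 < k -> G x y k -> G (x + k) y k -> G x (y + k) k ->
     G (x + k) (y + k) k -> G x y (k + k)) ->
  (forall s t, exists2 rho, 0 < rho & forall x' y' k, 0 < k < rho ->
     x' <= s <= x' + k -> y' <= t <= y' + k -> G x' y' k) ->
  G x y h.
Proof.
move=> h0 Gadd Gloc; apply: contrapT => nG.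
pose hh n : R := h / 2 ^+ n.
have hh0 n : 0 < hh n by rewrite divr_gt0 // exprn_gt0.
have hhS n : hh n = hh n.+1 + hh n.+1 by rewrite /hh exprS; field;
  rewrite expf_eq0 pnatr_eq0 andbF.
pose step k (p : R * R) : R * R :=
  if `[< ~ G p.1 p.2 k >] then p else
  if `[< ~ G (p.1 + k) p.2 k >] then (p.1 + k, p.2) else
  if `[< ~ G p.1 (p.2 + k) k >] then (p.1, p.2 + k) else (p.1 + k, p.2 + k).
pose st := fix st n := if n is m.+1 then step (hh n) (st m) else (x, y).
have bad n : ~ G (st n).1 (st n).2 (hh n).
  elim: n => [|n IH]; first by rewrite /hh expr0 divr1.
  rewrite /= /step.
  case: asboolP => // /contrapT g1; case: asboolP => // /contrapT g2.
  case: asboolP => // /contrapT g3 g4; apply: IH.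
  by rewrite hhS; apply: Gadd.
have mv n : ((st n.+1).1 = (st n).1 \/ (st n.+1).1 = (st n).1 + hh n.+1) /\
    ((st n.+1).2 = (st n).2 \/ (st n.+1).2 = (st n).2 + hh n.+1).
  by rewrite /= /step; do 3 (case: asboolP => _ /=; first by tauto); tauto.
have [s sP] : exists s, forall n, (st n).1 <= s <= (st n).1 + hh n.
  apply: nested_point => n; first exact: ltW.
  by have := hh0 n.+1; rewrite (hhS n); case: (mv n) => -[] -> _; split; lra.
have [t tP] : exists t, forall n, (st n).2 <= t <= (st n).2 + hh n.
  apply: nested_point => n; first exact: ltW.
  by have := hh0 n.+1; rewrite (hhS n); case: (mv n) => _ -[] ->; split; lra.
have [rho rho0 rhoP] := Gloc s t.
have [n hn] : exists n, hh n < rho.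
  have /cvgrPdist_lt : (fun n : nat => h * (2^-1 ^+ n)) @ \oo --> h * 0.
    apply: cvgMr; apply: cvg_expr; rewrite ger0_norm ?invr_ge0 //.
    by rewrite invf_lt1 // ltr1n.
  move=> /(_ _ rho0)[n _ nP]; exists n; have := nP n (leqnn n).
  rewrite /= mulr0 sub0r normrN /hh -exprVn ger0_norm //.
  by rewrite mulr_ge0 ?exprn_ge0 ?invr_ge0 // ltW.
by apply: (bad n); apply: rhoP; rewrite ?hh0 ?hn.
Qed.

Lemma complexD_real (x y k : R) : Complex x y + k%:C%C = Complex (x + k) y :> C.
Proof. by apply/eqP; rewrite eq_complex /= addr0 !eqxx. Qed.

Lemma complexD_imag (x y k : R) : Complex x y + 'i%C * k%:C%C = Complex x (y + k) :> C.
Proof. by apply/eqP; rewrite eq_complex /= !mul0r !mulr0 mul1r subr0 !addr0 add0r !eqxx. Qed.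

Lemma square_bd_sub (x y k : R) z : 0 <= k -> square_bd (Complex x y) k%:C%C z ->
  (x <= complex.Re z <= x + k) /\ (y <= complex.Im z <= y + k).
Proof.
move=> k0; have tk t : 0 <= t <= 1 -> 0 <= t * k <= k.
  by move=> /andP[t0 t1]; rewrite mulr_ge0 // ler_piMl.
have real t : t%:C%C * k%:C%C = (t * k)%:C%C :> C by rewrite rmorphM.
have imag t : t%:C%C * ('i%C * k%:C%C) = 'i%C * (t * k)%:C%C :> C by rewrite rmorphM mulrCA.
by move=> [[[]|]|] [t /tk /andP[t0 t1] ->];
  rewrite ?real ?imag ?(complexD_real, complexD_imag) /=; split; apply/andP; split; lra.
Qed.

Lemma square_bd_dist (x y k s t : R) z : 0 <= k ->
  x <= s <= x + k -> y <= t <= y + k ->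
  square_bd (Complex x y) k%:C%C z -> `|z - Complex s t| <= (k + k)%:C%C.
Proof.
move=> k0 xs yt /(square_bd_sub k0)[]; case: z => a b /= xa yb.
apply: le_trans (normc_ReIm _) _; rewrite lecR /=.
by apply: lerD; rewrite ler_norml; apply/andP; split; lra.
Qed.

(** How many of the two one-sided germs at [s] lie in the interval from [x] to [x + k].
    It is additive under halving, while being positive as soon as the closed interval
    contains [s]. *)
Definition germ_count (s x k : R) : nat := ((x <= s < x + k)%R + (x < s <= x + k)%R)%N.

Lemma germ_count_add s x k : 0 < k ->
  germ_count s x (k + k) = (germ_count s x k + germ_count s (x + k) k)%N.
Proof.
move=> k0; rewrite /germ_count addrA addnACA; congr (_ + _)%N.
- have [a|a] := lerP x s; have [b|b] := ltrP s (x + k);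
  have [c|c] := ltrP s (x + k + k) => //=; exfalso; lra.
- have [a|a] := ltrP x s; have [b|b] := lerP s (x + k);
  have [c|c] := lerP s (x + k + k) => //=; exfalso; lra.
Qed.

Lemma germ_count_gt0 s x k : 0 < k -> x <= s <= x + k -> (0 < germ_count s x k)%N.
Proof.
move=> k0 /andP[xs sk]; rewrite /germ_count xs sk /= andbT.
by have [//|a] := ltrP s (x + k); have [//|b] := ltrP x s; exfalso; lra.
Qed.

Lemma germ_count_le2 s x k : (germ_count s x k <= 2)%N.
Proof. by rewrite /germ_count; do 2 case: (_ && _). Qed.

(** Differentiability is in Caratheodory form, g u = g t + (u - t) gam(u) with [gam]
    continuous at t, and [z] may be a removable singularity.  Bisection is run on the bound
    |sum| <= e1 (area + number of germs of quadrants at [z] in the square), which is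
    additive.  A small square around t <> z satisfies it by the affine approximation,
    a small square around [z] because [g] is nearly constant there and the second
    term is at least 1. *)
Lemma goursat_square (g : C -> C) (z : C) (x y h : R) : 0 < h ->
  {for z, continuous g} ->
  (forall t, t != z -> exists2 gam : C -> C, {for t, continuous gam} &
     \forall u \near t, g u = g t + (u - t) * gam u) ->
  forall e : R, 0 < e -> \forall M \near \oo, `|sqsum g M (Complex x y) h%:C%C| <= e%:C%C.
Proof.
move=> h0 gz gt e e0.
pose psi (x y k : R) : nat := (germ_count (complex.Re z) x k * germ_count (complex.Im z) y k)%N.
pose e1 := e / (h ^+ 2 + 4).
have h20 : 0 < h ^+ 2 by rewrite exprn_gt0.
have e10 : 0 < e1 by rewrite divr_gt0 // addr_gt0.
pose G (x y k : R) := \forall M \near \oo,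
  `|sqsum g M (Complex x y) k%:C%C| <= (e1 * (k ^+ 2 + (psi x y k)%:R))%:C%C.
suff : G x y h.
  apply: filterS => M; move/le_trans; apply; rewrite lecR.
  have -> : e = e1 * (h ^+ 2 + 4) by rewrite /e1 divfK // gt_eqF // addr_gt0.
  rewrite ler_pM2l // lerD2l ler_nat.
  by rewrite (@leq_mul _ _ 2 2) // germ_count_le2.
apply: square_induction => // [{}x {}y k k0 g1 g2 g3 g4|s t].
  have : \forall M \near \oo, `|sqsum g M.+1 (Complex x y) (k + k)%:C%C| <=
      (e1 * ((k + k) ^+ 2 + (psi x y (k + k))%:R))%:C%C.
    apply: filterS2 (filterI g1 g2) (filterI g3 g4) => M [{}g1 {}g2] [{}g3 {}g4].
    rewrite rmorphD /= sqsum_double !(complexD_real, complexD_imag).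
    have -> : (e1 * ((k + k) ^+ 2 + (psi x y (k + k))%:R))%:C%C =
      (e1 * (k ^+ 2 + (psi x y k)%:R))%:C%C + (e1 * (k ^+ 2 + (psi (x + k) y k)%:R))%:C%C +
      (e1 * (k ^+ 2 + (psi x (y + k) k)%:R))%:C%C +
      (e1 * (k ^+ 2 + (psi (x + k) (y + k) k)%:R))%:C%C :> C.
      rewrite -!rmorphD /=; congr (_%:C%C); rewrite /psi !germ_count_add // !natrM !natrD.
      by ring.
    by do 3 (apply: (le_trans (ler_normD _ _)); apply: lerD => //).
  by move=> [M0 _ M0P]; exists M0.+1 => // -[//|M] /= MM; exact: M0P.
pose w : C := Complex s t.
have [wz|wz] := eqVneq w z.
  have := continuous_dist gz (ltr01 : (0 : C) < 1).
  move=> /nbhs_ballP[_ /= /gt0_realP[rho rho0 ->] rhoP].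
  exists (Num.min (rho / 2) (e1 / 4)); first by rewrite lt_min; apply/andP; split;
    apply: divr_gt0.
  move=> x' y' k; rewrite lt_min => /and3P[k0 krho ke] sx ty.
  apply: nearW => M; rewrite (_ : sqsum _ _ _ _ = sqsum (fun u => g u - (g z + 0 * u))
    M (Complex x' y') k%:C%C); last first.
    by rewrite sqsumB sqsum_affine subr0.
  apply: (le_trans (sqsum_le (e := 1) _ _)) => [u us|].
    rewrite mul0r addr0 distrC ltW // rhoP // -ball_normE /= -wz distrC.
    apply: le_lt_trans (square_bd_dist (ltW k0) sx ty us) _; rewrite ltcR; lra.
  rewrite mulr1 normc_real_complex gtr0_norm // (_ : (4 : C) = (4 : R)%:C%C);
    last by rewrite rmorph_nat.
  rewrite -rmorphM lecR.
  have psi1 : 1 <= (psi x' y' k)%:R :> R.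
    by rewrite ler1n muln_gt0 -wz !germ_count_gt0.
  apply: (@le_trans _ _ (e1 * 1)); first by lra.
  by rewrite ler_pM2l // (le_trans psi1) // lerDr sqr_ge0.
have [gam cgam gamE] := gt w wz.
have e80 : 0 < (e1 / 8)%:C%C :> C by rewrite ltcR divr_gt0.
have near2 : \forall u \near w, g u = g w + (u - w) * gam u /\
    `|gam w - gam u| < (e1 / 8)%:C%C.
  by apply: filterI => //; exact: continuous_dist.
move: near2 => /nbhs_ballP[_ /= /gt0_realP[rho rho0 ->] rhoP].
exists (rho / 2); first by rewrite divr_gt0.
move=> x' y' k /andP[k0 krho] sx ty; apply: nearW => M.
rewrite (_ : sqsum _ _ _ _ = sqsum (fun u => g u - ((g w - w * gam w) + gam w * u))
  M (Complex x' y') k%:C%C); last first.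
  by rewrite sqsumB sqsum_affine subr0.
apply: (le_trans (sqsum_le (e := (e1 / 8 * (k + k))%:C%C) _ _)) => [u us|].
  have uw := square_bd_dist (ltW k0) sx ty us.
  have [|gue gu] := rhoP u.
    rewrite -ball_normE /= distrC (le_lt_trans uw) // ltcR; lra.
  rewrite gue; have -> : g w + (u - w) * gam u - (g w - w * gam w + gam w * u) =
    (gam u - gam w) * (u - w) by ring.
  by rewrite normrM rmorphM ler_pM // distrC ltW.
rewrite normc_real_complex gtr0_norm // (_ : (4 : C) = (4 : R)%:C%C); last by rewrite rmorph_nat.
rewrite -!rmorphM lecR.
have -> : 4 * k * (e1 / 8 * (k + k)) = e1 * k ^+ 2 by field.
by rewrite ler_pM2l // lerDl.
Qed.

End Goursat.

(** * Cauchy's formula *)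

Section Cauchy.
Variable R : realType.
Local Notation C := R[i].

(** |1 - s|^2 <= |s|^2 - 1 when Re s >= 1, and |s|^2 - 1 <= (31/32)^2 |s|^2 when
    |s| <= 4. *)
Lemma inv_near1 (s : C) : 1 <= complex.Re s -> `|s| <= 4 -> `|s^-1 - 1| <= 31%:R / 32%:R.
Proof.
move=> s1 s4; have s0 : s != 0.
  by apply: contraTneq s1 => ->; rewrite /= -ltNge ltr01.
have -> : s^-1 - 1 = (1 - s) / s by rewrite mulrBl divff // mul1r.
rewrite normrM normfV ler_pdivrMr ?normr_gt0 //.
rewrite -(@ler_pXn2r _ 2) ?nnegrE ?mulr_ge0 ?divr_ge0 //.
have : `|s| ^+ 2 <= 4 ^+ 2 by rewrite lerXn2r ?nnegrE.
rewrite exprMn -!add_Re2_Im2.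
have -> : (4 ^+ 2 : C) = (4 ^+ 2 : R)%:C%C by rewrite rmorphXn /= rmorph_nat.
have -> : ((31 / 32) ^+ 2 : C) = ((31 / 32) ^+ 2 : R)%:C%C.
  by rewrite rmorphXn rmorphM fmorphV /= !rmorph_nat.
rewrite -rmorphM !lecR; case: s s1 {s4 s0} => x y /=.
by rewrite sub0r sqrrN; nra.
Qed.

Variable rho : R.
Hypothesis rho0 : 0 < rho.
(** The points t of evaluation have both coordinates at most rho in absolute value; a
    half-side of 4 rho ensures |t| <= |z| / 2 for z on the contour. *)
Definition corner : C := Complex (- (4 * rho)) (- (4 * rho)).
Definition side : C := (8 * rho)%:C%C.
Definition contour := square_bd corner side.

Lemma contour_far z : contour z -> `|complex.Re z| = 4 * rho \/ `|complex.Im z| = 4 * rho.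
Proof.
have n4 : `|4 * rho| = 4 * rho by rewrite gtr0_norm // mulr_gt0.
have m4 : `|- (4 * rho)| = 4 * rho by rewrite normrN n4.
have a4 : - (4 * rho) + 8 * rho = 4 * rho by ring.
rewrite /contour /side /corner /square_bd /= complexD_real complexD_imag a4.
move=> [[[]|]|] [t _ ->] /=; rewrite ?(mul0r, mulr0, subr0, addr0, mul1r, sub0r, oppr0); tauto.
Qed.

Lemma contour_box z : contour z -> cbox (4 * rho) z.
Proof.
move=> /(square_bd_sub (mulr_ge0 _ (ltW rho0)))[//|/andP[a b] /andP[c d]].
by split; rewrite ler_norml; apply/andP; split; lra.
Qed.

Lemma contour_norm z : contour z -> (4 * rho)%:C%C <= `|z|.
Proof. by move=> /contour_far[] <-; [exact: normc_Re | exact: normc_Im]. Qed.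

Lemma cbox_norm (a : R) z : cbox a z -> `|z| <= (a + a)%:C%C.
Proof. by move=> [x y]; apply: le_trans (normc_ReIm z) _; rewrite lecR lerD. Qed.

Lemma contour_neq z t : contour z -> cbox rho t -> z != t.
Proof.
move=> /contour_norm zn /cbox_norm tn; apply: contraTneq zn => ->.
apply/negP => /le_trans /(_ tn); rewrite lecR => h; have := rho0; lra.
Qed.

(** On the side of outer normal conj(k), the number (z - t) k has real part at least
    3 rho and modulus at most 10 rho; dividing by 3 rho puts it in the range of
    [inv_near1]. *)
Lemma contour_kernel z t (k : C) : contour z -> cbox rho t -> `|k| = 1 ->
  3 * rho <= complex.Re ((z - t) * k) ->
  `|(z - t)^-1 - k * ((3 * rho)^-1)%:C%C| <= (31 / 32 * (3 * rho)^-1)%:C%C.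
Proof.
move=> zc tb k1 rek; have r30 : 0 < 3 * rho by rewrite mulr_gt0.
have nm : `|(3 * rho)^-1| = (3 * rho)^-1 by rewrite gtr0_norm // invr_gt0.
have k0 : k != 0 by rewrite -normr_gt0 k1.
pose s := (z - t) * k * ((3 * rho)^-1)%:C%C.
have zt0 : z - t != 0 by rewrite subr_eq0 (contour_neq zc tb).
have n0 : (3 * rho)%:C%C != 0 :> C by rewrite fmorph_eq0 gt_eqF.
have sV : (z - t)^-1 = k * ((3 * rho)^-1)%:C%C * s^-1.
  have m0 : ((3 * rho)^-1)%:C%C != 0 :> C by rewrite fmorph_eq0 invr_eq0 gt_eqF.
  by rewrite /s; move: ((3 * rho)^-1)%:C%C m0 => m m0; field; rewrite zt0 k0 m0.
rewrite sV -{2}[k * _]mulr1 -mulrBr 2!normrM k1 mul1r normc_real_complex nm.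
have -> : (31 / 32 * (3 * rho)^-1)%:C%C = ((3 * rho)^-1)%:C%C * (31 / 32) :> C.
  by rewrite mulrC !rmorphM [in RHS]fmorphV [X in _ * (_ * X)]fmorphV /= !rmorph_nat fmorphV.
rewrite ler_pM2l ?ltcR ?invr_gt0 //.
apply: inv_near1.
  rewrite /s; case: ((z - t) * k) rek => a b /=; rewrite mulr0 subr0 => h.
  by rewrite ler_pdivlMr // mul1r.
rewrite /s normrM normrM k1 mulr1 normc_real_complex nm.
rewrite -[leRHS](mulfK n0) fmorphV ler_pM2r ?invr_gt0 ?ltcR //.
apply: le_trans (ler_normB _ _) _.
apply: le_trans (lerD (cbox_norm (contour_box zc)) (cbox_norm tb)) _.
rewrite -(rmorph_nat (real_complex R) 4) -rmorphM -rmorphD lecR; lra.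
Qed.

(** The discrete analogue of the integral of 1/(z - t), which is 2 i pi.  It is not
    constant in [t], but it stays in a disc around [winding_ref] that avoids 0; this
    is enough to divide by it and to approximate its inverse by polynomials. *)
Definition winding_sum M t := sqsum (fun z => (z - t)^-1) M corner side.
Definition winding_ref : C := 4 * 'i%C * side * ((3 * rho)^-1)%:C%C.

Lemma winding_sum_near M t : cbox rho t ->
  `|winding_sum M t - winding_ref| <= 31 / 32 * `|winding_ref|.
Proof.
move=> tb; pose e := (31 / 32 * (3 * rho)^-1)%:C%C : C.
have [/andP[t1 t2] /andP[t3 t4]] :
  (- rho <= complex.Re t <= rho) /\ (- rho <= complex.Im t <= rho).
  by case: tb; rewrite !ler_norml.
have kernel k (S : set C) : S `<=` contour -> `|k| = 1 ->
    (forall z, S z -> 3 * rho <= complex.Re ((z - t) * k)) ->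
    forall z, S z -> `|(z - t)^-1 - k * ((3 * rho)^-1)%:C%C| <= e.
  by move=> SQ k1 kS z Sz; apply: contour_kernel => //; [exact: SQ | exact: kS].
have a4 : - (4 * rho) + 8 * rho = 4 * rho by ring.
have seg (k d : C) (x y : R) : `|k| = 1 -> on_segment (Complex x y) d `<=` contour ->
    (forall z : C, on_segment (Complex x y) d z -> 3 * rho <= complex.Re ((z - t) * k)) ->
    `|midsum (fun z : C => (z - t)^-1) M (Complex x y)
      d - d * (k * ((3 * rho)^-1)%:C%C)| <= `|d| * e.
  by move=> k1 sub kS; apply: midsum_near; exact: kernel.
have n1 : `|- 1 : C| = 1 by rewrite normrN normr1.
have ni : `|- 'i%C : C| = 1 by rewrite normrN normc_i.
have nside : `|side| = side by rewrite /side normc_real_complex gtr0_norm // mulr_gt0.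
have nis : `|'i%C * side| = side by rewrite normrM normc_i mul1r.
have sub0 : on_segment corner side `<=` contour by move=> z zs; rewrite /contour /square_bd /=;
  tauto.
have sub1 : on_segment (corner + side) ('i%C * side) `<=` contour by move=> z zs;
  rewrite /contour /square_bd /=; tauto.
have sub2 : on_segment (corner + 'i%C * side) side `<=` contour by move=> z zs;
  rewrite /contour /square_bd /=; tauto.
have sub3 : on_segment corner ('i%C * side) `<=` contour by move=> z zs;
  rewrite /contour /square_bd /=; tauto.
rewrite /corner /side complexD_real complexD_imag -/side a4 in sub0 sub1 sub2 sub3.
have hor (x y s : R) : complex.Im (Complex x y + s%:C%C * side) = y.
  by rewrite /side -rmorphM complexD_real.
have ver (x y s : R) : complex.Re (Complex x y + s%:C%C * ('i%C * side)) = x.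
  by rewrite /side mulrCA -rmorphM complexD_imag.
have Rei (u : C) : complex.Re (u * 'i%C) = - complex.Im u by rewrite ReiNIm.
have ReB (u v : C) : complex.Re (u - v) = complex.Re u - complex.Re v by case: u; case: v.
have ImB (u v : C) : complex.Im (u - v) = complex.Im u - complex.Im v by case: u; case: v.
have ReN (u : C) : complex.Re (- u) = - complex.Re u by case: u.
have b0 := seg 'i%C _ _ _ (normc_i R) sub0 _.
have b1 := seg 1 _ _ _ (normr1 C) sub1 _.
have b2 := seg (- 'i%C) _ _ _ ni sub2 _.
have b3 := seg (- 1) _ _ _ n1 sub3 _.
move: {seg kernel sub0 sub1 sub2 sub3} b0 b1 b2 b3; rewrite nis nside => b0 b1 b2 b3.
have {b0} b0 := b0 ltac:(move=> _ [s _ ->]; rewrite Rei ImB hor; lra).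
have {b1} b1 := b1 ltac:(move=> _ [s _ ->]; rewrite mulr1 ReB ver; lra).
have {b2} b2 := b2 ltac:(move=> _ [s _ ->]; rewrite mulrN ReN Rei ImB hor; lra).
have {b3} b3 := b3 ltac:(move=> _ [s _ ->]; rewrite mulrN1 ReN ReB ver; lra).
rewrite /winding_sum /sqsum /winding_ref {1 2 3}/corner complexD_real complexD_imag -/side a4.
set s0 := midsum _ _ _ _ in b0 *; set s1 := midsum _ _ _ _ in b1 *.
set s2 := midsum _ _ _ _ in b2 *; set s3 := midsum _ _ _ _ in b3 *.
have em : e = 31 / 32 * ((3 * rho)^-1)%:C%C.
  by rewrite /e !rmorphM [X in _ * X * _]fmorphV /= !rmorph_nat.
have nm : `|((3 * rho)^-1)%:C%C : C| = ((3 * rho)^-1)%:C%C.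
  by rewrite normc_real_complex gtr0_norm // invr_gt0 mulr_gt0.
rewrite {}em in b0 b1 b2 b3; move: {e} ((3 * rho)^-1)%:C%C nm b0 b1 b2 b3 => m nm b0 b1 b2 b3.
have -> : `|4 * 'i%C * side * m| = 4 * side * m :> C.
  by rewrite !normrM nm nside normc_i normr_nat mulr1.
have -> : s0 + s1 - s2 - s3 - 4 * 'i%C * side * m =
    (s0 - side * ('i%C * m)) + (s1 - 'i%C * side * (1 * m)) -
    (s2 - side * (- 'i%C * m)) - (s3 - 'i%C * side * (- 1 * m)) by ring.
have -> : 31 / 32 * (4 * side * m) = side * (31 / 32 * m) + side * (31 / 32 * m) +
  side * (31 / 32 * m) + side * (31 / 32 * m) :> C by field.
do 2 (apply: le_trans (ler_normB _ _) _; apply: lerD => //).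
by apply: le_trans (ler_normD _ _) _; apply: lerD.
Qed.

Lemma winding_ref_neq0 : winding_ref != 0.
Proof.
have i0 : 'i%C != 0 :> C by rewrite -normr_eq0 normc_i oner_eq0.
rewrite /winding_ref /side !mulf_eq0 pnatr_eq0 (negbTE i0) !fmorph_eq0 invr_eq0.
by rewrite !mulf_eq0 !pnatr_eq0 (gt_eqF rho0).
Qed.

(** [Phi v] is a holomorphic function depending on a parameter [v], to be evaluated at
    the point [tau v]. *)
Variables (T : topologicalType) (X : set T) (Phi : T -> C -> C) (tau : T -> C).
Hypothesis Xc : compact X.
Hypothesis cPhi : forall v z, {for (v, z), continuous (fun p : T * C => Phi p.1 p.2)}.
Hypothesis ctau : continuous tau.
Hypothesis tauX : forall v, X v -> cbox rho (tau v).
Hypothesis dPhi : forall v t, exists2 gam : C -> C, {for t, continuous gam} &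
  forall z, Phi v z = Phi v t + (z - t) * gam z.

Definition cauchy_quot v z := (Phi v z - Phi v (tau v)) / (z - tau v).

Lemma on_segment_compact (a d : C) : compact (on_segment a d).
Proof.
have -> : on_segment a d = (fun t : R => a + t%:C%C * d) @` `[0, 1].
  by apply/seteqP; split=> [_ [t t01 ->]|_ [t /= t01 <-]]; exists t;
    rewrite //= ?in_itv //; move: t01; rewrite in_itv.
apply: continuous_compact; last exact: segment_compact.
apply: continuous_subspaceT => t.
apply: (@continuous_atD _ R t (fun=> a) (fun t : R => t%:C%C * d));
  first exact: continuous_at_cst.
apply: (@continuous_atM _ R t (fun t : R => t%:C%C) (fun=> d)); last exact: continuous_at_cst.
exact: continuous_real_complex.
Qed.

Lemma contour_compact : compact contour.
Proof. by do 3 (apply: compactU; last exact: on_segment_compact); exact: on_segment_compact. Qed.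

Lemma cauchy_quot_continuous v z : z != tau v ->
  {for (v, z), continuous (fun p : T * C => cauchy_quot p.1 p.2)}.
Proof.
move=> zt; have ct : {for (v, z), continuous (fun p : T * C => tau p.1)}.
  apply: (@continuous_comp _ _ _ fst tau); [exact: cvg_fst | exact: ctau].
apply: continuous_atM; first apply: continuous_atB; first exact: cPhi.
  apply: (@continuous_comp _ _ _ (fun p : T * C => (p.1, tau p.1)) (fun p => Phi p.1 p.2));
    last exact: cPhi.
  apply: (@cvg_pair _ _ _ (nbhs (v, z)) (nbhs v) (nbhs (tau v)) _ _ _ fst (fun p => tau p.1)).
    exact: cvg_fst.
  exact: ct.
apply: continuous_atV; first by rewrite subr_eq0.
by apply: (@continuous_atB _ _ (v, z) snd (fun p => tau p.1)); [exact: cvg_snd | exact: ct].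
Qed.

(** The quotient extends continuously to [tau v], with value the derivative, and is
    differentiable elsewhere: Goursat's lemma applies. *)
Lemma cauchy_quot_small v e : X v -> 0 < e ->
  \forall M \near \oo, `|sqsum (cauchy_quot v) M corner side| <= e%:C%C.
Proof.
move=> Xv e0; have [g cg gE] := dPhi v (tau v).
have quotE z : z != tau v -> cauchy_quot v z = g z.
  by move=> zt; rewrite /cauchy_quot gE addrC addKr mulrC mulKf // subr_eq0.
have side0 : 0 < 8 * rho by rewrite mulr_gt0.
have := goursat_square (- (4 * rho)) (- (4 * rho)) side0 cg.
move=> /(_ _ e e0) h; apply: filterS (h _) => [M|t tz].
  rewrite -/corner -/side (eq_sqsum (G := g)) // => z; rewrite inE => zc.
  exact: quotE (contour_neq zc (tauX Xv)).
have [G cG GE] := dPhi v t.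
have tz0 : t - tau v != 0 by rewrite subr_eq0.
exists (fun u => G u * (u - tau v)^-1 -
   (Phi v t - Phi v (tau v)) * ((u - tau v)^-1 * (t - tau v)^-1)).
  have cV : {for t, continuous (fun u : C => (u - tau v)^-1)}.
    apply: (@continuous_atV _ C t (fun u => u - tau v)); first exact: tz0.
    by apply: (@continuous_atB _ C t id (fun=> tau v));
      [exact: cvg_id | exact: continuous_at_cst].
  apply: (@continuous_atB _ C t (fun u => G u * (u - tau v)^-1)
    (fun u => (Phi v t - Phi v (tau v)) * ((u - tau v)^-1 * (t - tau v)^-1))).
    exact: (continuous_atM cG cV).
  apply: (@continuous_atM _ C t (fun=> _) (fun u => (u - tau v)^-1 * (t - tau v)^-1)).
    exact: continuous_at_cst.
  apply: (@continuous_atM _ C t (fun u => (u - tau v)^-1) (fun=> (t - tau v)^-1)).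
    exact: cV.
  exact: continuous_at_cst.
have : \forall u \near t, u != tau v.
  have := @near_dist_lt C C t `|t - tau v| (_ : 0 < `|t - tau v|).
  rewrite normr_gt0 => /(_ tz0); apply: filterS => u.
  by apply: contraTneq => ->; rewrite ltxx.
apply: filterS => u uz; have uz0 : u - tau v != 0 by rewrite subr_eq0.
rewrite -quotE // -quotE // /cauchy_quot (GE u).
by field; rewrite uz0 tz0.
Qed.

Lemma cauchy_quot_equi v0 (e : C) : X v0 -> 0 < e ->
  \forall v \near v0, forall z, contour z -> `|cauchy_quot v z - cauchy_quot v0 z| <= e.
Proof.
move=> Xv0 e0; have e20 : 0 < e / 2 by rewrite divr_gt0.
apply: ((compact_near_coveringP contour).1 contour_compact _ _
  (fun v z => `|cauchy_quot v z - cauchy_quot v0 z| <= e)) => z zc.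
have := continuous_dist (cauchy_quot_continuous (contour_neq zc (tauX Xv0))) e20.
move=> [[A B] /= [Av0 Bz] AB].
exists (B, A) => // -[z' v] /= [Bz' Av].
have h1 := AB (v, z') (conj Av Bz').
have h2 := AB (v0, z') (conj (nbhs_singleton Av0) Bz').
rewrite -(subrKA (cauchy_quot v0 z)) (le_trans (ler_normD _ _)) //.
by rewrite [e]splitr lerD // ltW // distrC.
Qed.

(** Pointwise convergence to 0 in [v] is uniform on compact sets, by equicontinuity of
    the sums: they depend only on the values on the contour. *)
Lemma cauchy_quot_unif e : 0 < e ->
  \forall M \near \oo, forall v, X v -> `|sqsum (cauchy_quot v) M corner side| <= e%:C%C.
Proof.
move=> e0; apply: ((compact_near_coveringP X).1 Xc _ _
  (fun M v => `|sqsum (cauchy_quot v) M corner side| <= e%:C%C)) => v0 Xv0.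
have e20 : 0 < e / 2 by rewrite divr_gt0.
have side0 : 0 < side by rewrite ltcR mulr_gt0.
have e40 : 0 < (e / 2)%:C%C / (4 * side) :> C by rewrite divr_gt0 ?mulr_gt0 // ltcR.
exists ([set v | forall z, contour z ->
  `|cauchy_quot v z - cauchy_quot v0 z| <= (e / 2)%:C%C / (4 * side)],
  [set M | `|sqsum (cauchy_quot v0) M corner side| <= (e / 2)%:C%C]).
  by split; [exact: cauchy_quot_equi | exact: cauchy_quot_small].
move=> [v M] [/= vv0 M0].
rewrite -[sqsum _ _ _ _](subrK (sqsum (cauchy_quot v0) M corner side)) -sqsumB.
rewrite (le_trans (ler_normD _ _)) // [e]splitr rmorphD; apply: lerD.
  apply: le_trans (@sqsum_le _ (fun z => cauchy_quot v z - cauchy_quot v0 z)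
    _ M corner side vv0) _.
  rewrite (ger0_norm (ltW side0)).
  have s40 : 4 * side != 0 by rewrite mulf_neq0 ?pnatr_eq0 ?lt0r_neq0.
  by rewrite [leLHS]mulrC divfK.
exact: M0.
Qed.

Lemma winding_sum_ge M t : cbox rho t -> `|winding_ref| / 32 <= `|winding_sum M t|.
Proof.
move=> /(winding_sum_near M) h.
have -> : `|winding_ref| / 32 = `|winding_ref| - 31 / 32 * `|winding_ref| by field.
rewrite lerBlDr -[X in `|X| <= _](subrK (winding_sum M t)) addrC (le_trans (ler_normD _ _)) //.
by rewrite lerD2l distrC.
Qed.

Lemma cauchy_formula e : 0 < e -> exists M, forall v, X v ->
  `|Phi v (tau v) - sqsum (fun z => Phi v z * (z - tau v)^-1) M corner side
     * (winding_sum M (tau v))^-1| <= e%:C%C.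
Proof.
move=> e0; have w0 : 0 < `|winding_ref| / 32 by rewrite divr_gt0 // normr_gt0 winding_ref_neq0.
have [w w00 wE] := gt0_realP w0.
have [M _ /(_ M (leqnn M)) MP] := cauchy_quot_unif (mulr_gt0 e0 w00).
exists M => v Xv; have Wge := winding_sum_ge M (tauX Xv).
have W0 : winding_sum M (tau v) != 0 by rewrite -normr_gt0 (lt_le_trans w0).
set S := sqsum _ _ _ _; set W := winding_sum _ _ in Wge W0 *.
have -> : Phi v (tau v) - S * W^-1 = (Phi v (tau v) * W - S) / W.
  by move: W W0 {Wge} => W W0; field.
rewrite normrM normfV ler_pdivrMr ?normr_gt0 // distrC.
have <- : sqsum (cauchy_quot v) M corner side = S - Phi v (tau v) * W.
  by rewrite /W /winding_sum -sqsumZ -sqsumB; apply: eq_sqsum => z _; rewrite -mulrBl.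
apply: le_trans (MP v Xv) _; rewrite (_ : (e * w)%:C%C = e%:C%C * (`|winding_ref| / 32));
  last by rewrite wE rmorphM.
by rewrite ler_pM2l // ltcR.
Qed.

End Cauchy.

(** * Polynomial approximation of holomorphic functions *)

Section Approximable.
Variables (R : realType) (n : nat) (rho : R).
Local Notation C := R[i].
Implicit Types f g : 'rV[C]_n -> C.

Definition approximable f := forall e : C, 0 < e ->
  exists2 p, FiniteMap.polyfun p & forall v, polybox rho v -> `|f v - p (v ord0)| <= e.

Lemma approximable_polyfun p : FiniteMap.polyfun p -> approximable (fun v => p (v ord0)).
Proof. by move=> pp e e0; exists p => // v _; rewrite subrr normr0 ltW. Qed.

Lemma approximable_cst c : approximable (fun=> c).
Proof. exact: (approximable_polyfun (FiniteMap.polyfun_cst n c)). Qed.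

Lemma approximable_coord i : approximable (fun v => v ord0 i).
Proof. exact: (approximable_polyfun (FiniteMap.polyfun_coord C i)). Qed.

Lemma eq_approximable f g : (forall v, polybox rho v -> f v = g v) -> approximable f ->
  approximable g.
Proof.
by move=> fg af e /af[p pp pf]; exists p => // v vX; rewrite -fg // pf.
Qed.

Lemma approximable_lim f : (forall e : C, 0 < e -> exists2 g, approximable g &
  forall v, polybox rho v -> `|f v - g v| <= e) -> approximable f.
Proof.
move=> lf e e0; have e20 : 0 < e / 2 by rewrite divr_gt0.
have [g /(_ _ e20)[p pp pg] fg] := lf _ e20; exists p => // v vX.
rewrite -(subrKA (g v)) (le_trans (ler_normD _ _)) // [e]splitr.
by rewrite lerD ?fg ?pg.
Qed.

Lemma approximableD f g : approximable f -> approximable g -> approximable (fun v => f v + g v).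
Proof.
move=> af ag e e0; have e20 : 0 < e / 2 by rewrite divr_gt0.
have [[p pp pf] [q qq qg]] := (af _ e20, ag _ e20).
exists (fun v => p v + q v); first exact: FiniteMap.polyfunD.
move=> v vX; rewrite opprD addrACA (le_trans (ler_normD _ _)) // [e]splitr.
by rewrite lerD ?pf ?qg.
Qed.

Lemma polyfun_polybox p : FiniteMap.polyfun p ->
  exists2 B : C, 0 < B & forall v : 'rV[C]_n, polybox rho v -> `|p (v ord0)| <= B.
Proof.
move=> pp; pose b : C := 1 + (`|rho| + `|rho|)%:C%C.
have b1 : 1 <= b by rewrite /b lerDl ler0c addr_ge0.
have [B B0 pB] := FiniteMap.polyfun_bounded pp b1.
exists (B + 1) => [|v vX]; first by rewrite (lt_le_trans ltr01) // lerDr.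
apply: le_trans (pB _ _) _; last by rewrite lerDl.
move=> i; apply: (le_trans (cbox_norm (vX i))).
apply: (@le_trans _ _ (`|rho| + `|rho|)%:C%C); last by rewrite /b lerDr.
by rewrite lecR lerD // ler_norm.
Qed.

Lemma approximable_bounded f : approximable f ->
  exists2 B : C, 0 < B & forall v : 'rV[C]_n, polybox rho v -> `|f v| <= B.
Proof.
move=> /(_ 1 ltr01)[p /polyfun_polybox[B B0 pB] fp].
exists (1 + B) => [|v vX]; first by rewrite addr_gt0.
by rewrite -(subrK (p (v ord0)) (f v)) (le_trans (ler_normD _ _)) // lerD ?fp ?pB.
Qed.

Lemma approximableM f g : approximable f -> approximable g -> approximable (fun v => f v * g v).
Proof.
move=> af ag e e0; have [Bf Bf0 fB] := approximable_bounded af.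
have [|q qq qg] := ag (e / 2 / Bf); first by rewrite !divr_gt0.
have [Bq Bq0 qB] := polyfun_polybox qq.
have [|p pp pf] := af (e / 2 / Bq); first by rewrite !divr_gt0.
exists (fun v => p v * q v); first exact: FiniteMap.polyfunM.
move=> v vX.
have -> : f v * g v - p (v ord0) * q (v ord0) =
  (g v - q (v ord0)) * f v + (f v - p (v ord0)) * q (v ord0) by ring.
rewrite (le_trans (ler_normD _ _)) // !normrM [e]splitr lerD //.
  by rewrite -[leRHS](divfK (lt0r_neq0 Bf0)) ler_pM ?qg ?fB.
by rewrite -[leRHS](divfK (lt0r_neq0 Bq0)) ler_pM ?pf ?qB.
Qed.

Lemma approximableB f g : approximable f -> approximable g -> approximable (fun v => f v - g v).
Proof.
move=> af ag; apply: (@eq_approximable (fun v => f v + -1 * g v)) => [v _|].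
  by rewrite mulN1r.
by apply: approximableD => //; apply: approximableM => //; exact: approximable_cst.
Qed.

Lemma small_expr (q e : C) : 0 <= q -> q < 1 -> 0 < e -> exists k, q ^+ k <= e.
Proof.
move=> q0 q1 /gt0_realP[r r0 ->].
have [x qE] : exists x : R, q = x%:C%C by apply/complex_realP/ger0_real.
move: q0 q1; rewrite qE ler0c (_ : 1 = 1%:C%C) // ltcR => x0 x1.
have : (fun k : nat => x ^+ k) @ \oo --> (0 : R) by apply: cvg_expr; rewrite ger0_norm.
move=> /cvgrPdist_lt/(_ _ r0)[k _ /(_ k (leqnn k))] /=.
rewrite sub0r normrN ger0_norm ?exprn_ge0 // => h.
by exists k; rewrite -rmorphXn lecR ltW.
Qed.

(** The geometric series of (c - f) / c. *)
Lemma approximableV f (c q : C) : approximable f -> c != 0 -> 0 <= q -> q < 1 ->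
  (forall v, polybox rho v -> `|f v - c| <= q * `|c|) -> approximable (fun v => (f v)^-1).
Proof.
move=> af c0 q0 q1 fc; pose u v := (c - f v) / c.
have uq v : polybox rho v -> `|u v| <= q.
  by move=> vX; rewrite normrM normfV ler_pdivrMr ?normr_gt0 // distrC fc.
have u1 v : polybox rho v -> 1 - q <= `|1 - u v|.
  move=> vX; have := ler_normD (1 - u v) (u v); rewrite subrK normr1.
  by rewrite lerBlDr => /le_trans; apply; rewrite lerD2l uq.
have q10 : 0 < 1 - q by rewrite subr_gt0.
apply: approximable_lim => e e0.
have [|k qk] := @small_expr q (e * (1 - q) * `|c|) q0 q1.
  by rewrite !mulr_gt0 ?normr_gt0.
exists (fun v => c^-1 * \sum_(i < k) u v ^+ i).
  apply: approximableM; first exact: approximable_cst.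
  have au : approximable u by apply: approximableM; [apply: approximableB => //;
    exact: approximable_cst | exact: approximable_cst].
  have auX m : approximable (fun v => u v ^+ m).
    elim: m => [|m IH]; first exact: approximable_cst.
    by apply: eq_approximable (approximableM au IH) => v _; rewrite exprS.
  elim: (k) => [|m IH].
    by apply: eq_approximable (approximable_cst 0) => v _; rewrite big_ord0.
  by apply: eq_approximable (approximableD IH (auX m)) => v _; rewrite big_ord_recr.
move=> v vX; have u10 : 1 - u v != 0.
  by rewrite -normr_gt0 (lt_le_trans q10) // u1.
have fE : f v = c * (1 - u v) by rewrite /u; field.
have -> : (f v)^-1 - c^-1 * \sum_(i < k) u v ^+ i = u v ^+ k / (c * (1 - u v)).
  have := subrX1 (u v) k; move: (\sum_(i < k) _) => S uS.
  rewrite fE (_ : u v ^+ k = (u v - 1) * S + 1); last by rewrite -uS subrK.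
  by field; rewrite c0 u10.
rewrite normrM normrX normfV [`|c * _|]normrM ler_pdivrMr ?mulr_gt0 ?normr_gt0 //.
apply: (@le_trans _ _ (q ^+ k)); first by apply: lerXn2r; rewrite ?nnegrE ?uq.
apply: (le_trans qk); rewrite -mulrA ler_pM2l // mulrC ler_pM2l ?normr_gt0 //.
exact: u1.
Qed.

Lemma approximable_midsum (Psi : 'rV[C]_n -> C -> C) M a d :
  (forall z, on_segment a d z -> approximable (fun v => Psi v z)) ->
  approximable (fun v => midsum (Psi v) M a d).
Proof.
elim: M a d => [|M IH] a d aP /=.
  by apply: approximableM; [exact: approximable_cst | apply: aP; exact: on_segment_mid].
apply: approximableD; apply: IH => z zs; apply: aP.
- exact: on_segment_l.
- exact: on_segment_r.
Qed.

Lemma approximable_sqsum (Psi : 'rV[C]_n -> C -> C) M c h :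
  (forall z, square_bd c h z -> approximable (fun v => Psi v z)) ->
  approximable (fun v => sqsum (Psi v) M c h).
Proof.
move=> aP; rewrite /sqsum; have sub S : S `<=` square_bd c h ->
    forall z, S z -> approximable (fun v => Psi v z) by move=> Sc z /Sc; exact: aP.
do 2 (apply: approximableB; last by apply/approximable_midsum/sub => z; rewrite /square_bd /=;
  tauto).
by apply: approximableD; apply/approximable_midsum/sub => z; rewrite /square_bd /=; tauto.
Qed.

End Approximable.

Section PolynomialDensity.
Variables (R : realType) (n : nat).
Local Notation C := R[i].

Definition set_coord (c : 'rV[C]_n) (k : 'I_n) (z : C) : 'rV[C]_n :=
  \row_j if j == k then z else c ord0 j.

Definition glue (k : nat) (v c : 'rV[C]_n) : 'rV[C]_n :=
  \row_j if (j < k)%N then v ord0 j else c ord0 j.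

(** Caratheodory form of complex differentiability in each variable. *)
Definition separately_holomorphic (F : 'rV[C]_n -> C) :=
  forall c k t, exists2 gam : C -> C, {for t, continuous gam} &
    forall z, F (set_coord c k z) = F (set_coord c k t) + (z - t) * gam z.

(** Cauchy's formula in the last varying coordinate expresses F, up to a uniform error,
    by values of F with this coordinate frozen on the contour, by kernels
    1/(zeta - z_k) and by the inverse of the winding sum. *)
Theorem polynomial_density (F : 'rV[C]_n -> C) (rho : R) : 0 < rho -> continuous F ->
  separately_holomorphic F -> approximable rho F.
Proof.
move=> rho0 cF dF.
have claim k c : (k <= n)%N -> approximable rho (fun v => F (glue k v c)).
  elim: k c => [|k IH] c kn.
    apply: (@eq_approximable _ _ _ (fun=> F c)) => [v _|]; last exact: approximable_cst.
    by congr F; apply/rowP => j; rewrite mxE.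
  pose kk := Ordinal kn.
  pose Phi (v : 'rV[C]_n) z := F (glue k v (set_coord c kk z)).
  pose tau (v : 'rV[C]_n) := v ord0 kk.
  have cPhi v z : {for (v, z), continuous (fun p : 'rV[C]_n * C => Phi p.1 p.2)}.
    apply: (@continuous_comp _ _ _ (fun p :
      'rV[C]_n * C => glue k p.1 (set_coord c kk p.2)) F); last exact: cF.
    apply: continuous_at_rV => j.
    have -> : (fun p : 'rV[C]_n * C => glue k p.1 (set_coord c kk p.2) ord0 j) =
        (fun p => if (j < k)%N then p.1 ord0 j else if j == kk then p.2 else c ord0 j).
      by apply/funext => p; rewrite !mxE.
    case: (j < k)%N.
      apply: (@continuous_comp _ _ _ fst (fun v : 'rV[C]_n => v ord0 j)); first exact: cvg_fst.
      exact: continuous_at_coord.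
    by case: (j == kk); [exact: cvg_snd | exact: continuous_at_cst].
  have dPhi v t : exists2 gam : C -> C, {for t, continuous gam} &
      forall z, Phi v z = Phi v t + (z - t) * gam z.
    have [gam cg gE] := dF (glue k v c) kk t; exists gam => // z.
    suff e y : glue k v (set_coord c kk y) = set_coord (glue k v c) kk y by rewrite /Phi !e.
    apply/rowP => j; rewrite !mxE; case: eqP => [->|//] /=.
    by rewrite ltnn.
  have Phi_tau v : Phi v (tau v) = F (glue k.+1 v c).
    congr F; apply/rowP => j; rewrite !mxE ltnS [(j <= k)%N]leq_eqVlt.
    rewrite -[(j : nat) == k]/(j == kk); case: eqP => [->|_] /=; first by rewrite ltnn.
    by case: ifP.
  have ker z : contour rho z -> approximable rho (fun v => (z - tau v)^-1).
    move=> zc; have zn := contour_norm rho0 zc.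
    apply: (@approximableV _ _ _ _ z (1 / 2)).
    - by apply: approximableB; [exact: approximable_cst | exact: approximable_coord].
    - by rewrite -normr_gt0 (lt_le_trans _ zn) // ltcR mulr_gt0.
    - by rewrite divr_ge0.
    - by rewrite ltr_pdivrMr // mul1r ltr1n.
    move=> v vX; rewrite addrC addKr normrN.
    apply: (le_trans (cbox_norm (vX kk))).
    have -> : (rho + rho)%:C%C = 1 / 2 * (4 * rho)%:C%C :> C.
      have -> : rho + rho = 2^-1 * (4 * rho) by field.
      by rewrite rmorphM fmorphV /= rmorph_nat mul1r.
    by rewrite ler_pM2l // divr_gt0.
  apply: approximable_lim => e /gt0_realP[r r0 ->].
  have [M MP] := cauchy_formula rho0 (@compact_polybox R n rho) cPhi
    (@continuous_at_coord R n ^~ kk) (fun v vX => vX kk) dPhi r0.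
  exists (fun v => sqsum (fun z => Phi v z * (z - tau v)^-1) M (corner rho) (side rho)
     * (winding_sum rho M (tau v))^-1); last by move=> v vX; rewrite -Phi_tau MP.
  apply: approximableM.
    apply: approximable_sqsum => z zc; apply: approximableM; last exact: ker.
    by apply: IH; exact: ltnW.
  apply: (@approximableV _ _ _ _ (winding_ref rho) (31 / 32)).
  - by apply: approximable_sqsum => z zc; exact: ker.
  - exact: winding_ref_neq0.
  - by rewrite divr_ge0.
  - by rewrite ltr_pdivrMr // mul1r ltr_nat.
  - by move=> v vX; apply: winding_sum_near => //; exact: vX.
apply: eq_approximable (claim n 0 (leqnn n)) => v _; congr F.
by apply/rowP => j; rewrite mxE ltn_ord.
Qed.

End PolynomialDensity.

(** * Components of compact sets *)

Section QuasiComponents.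
Variables (T : topologicalType) (K A : set T) (p : T).
Hypotheses (T2 : hausdorff_space T) (Kc : compact K) (AK : A `<=` K°).
Hypotheses (Acl : closed A) (Ap : A p).

Lemma closed_shrinking (E O : set T) : closed E -> E `<=` A -> open O -> E `<=` O ->
  exists V, [/\ open V, E `<=` V & closure V `<=` O].
Proof.
move=> Ecl EA Oo EO.
have [W /set_nbhsP[V [Vo EV VW]] WO] : filter_from (set_nbhs E) closure O.
  apply: (compact_normal_local T2 Kc (subset_trans EA AK) Ecl).
  by apply/set_nbhsP; exists O; split.
by exists V; split => //; apply: subset_trans WO; exact: closureS.
Qed.

Definition clopen_part (C : set T) := [/\ C p, C `<=` A, closed C & closed (A `\` C)].

Let quasi_component := \bigcap_(C in clopen_part) C.

Lemma clopen_partI C D : clopen_part C -> clopen_part D -> clopen_part (C `&` D).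
Proof.
move=> [Cp CA Ccl ACcl] [Dp DA Dcl ADcl]; split => //.
- by move=> x [/CA].
- exact: closedI.
- by rewrite setDIr; exact: closedU.
Qed.

Lemma clopen_part_full : clopen_part A.
Proof. by split => //; rewrite setDv; exact: closed0. Qed.

(** Clopen parts are stable under intersection, so by compactness a single one
    suffices. *)
Lemma clopen_part_avoids (L : set T) : compact L -> L `&` quasi_component = set0 ->
  exists2 C, clopen_part C & C `&` L = set0.
Proof.
move=> Lc LQ.
pose F : set_system (set T) :=
  filter_from clopen_part (fun C => [set D | clopen_part D /\ D `<=` C]).
have FF : Filter F.
  apply: filter_from_filter; first by exists A; exact: clopen_part_full.
  move=> C D Cc Dc; exists (C `&` D); first exact: clopen_partI.
  by move=> E [Ec ECD]; split; split => // x /ECD[].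
have [|C Cc CP] := (compact_near_coveringP L).1 Lc _ F (fun C x => ~ C x) FF.
  move=> x Lx; have : ~ quasi_component x.
    by move=> Qx; have : set0 x by rewrite -LQ.
  move=> /existsNP[C /not_implyP[Cc Cx]].
  exists (~` C, [set D | clopen_part D /\ D `<=` C]).
    split; last by exists C.
    by case: Cc => _ _ Ccl _; apply: open_nbhs_nbhs; split => //; exact: closed_openC.
  by move=> [y D] [/= Cy [_ DC]] /DC.
exists C => //; apply/seteqP; split=> // x [Cx Lx].
by have := CP C (conj Cc (@subset_refl _ C)) x Lx.
Qed.

Lemma quasi_component_closed : closed quasi_component.
Proof. by apply: closed_bigI => C [_ _ Ccl _]. Qed.

Lemma quasi_component_sub : quasi_component `<=` A.
Proof. by move=> x /(_ _ clopen_part_full). Qed.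

(** If the intersection of all clopen parts split into two closed pieces, an open
    set [V] around the piece of [p] with closure disjoint from the other piece would
    cut some clopen part avoiding the boundary of [V] into a smaller clopen part. *)
Lemma quasi_component_connected : connected quasi_component.
Proof.
apply: contrapT => /connectedPn[E [E0 QE [E1 E2]]].
have [b Ebp] : exists b, E b p.
  have : quasi_component p by move=> C [].
  by rewrite QE => -[]; [exists false | exists true].
have Qsub c : E c `<=` quasi_component by rewrite QE => x Ex; case: c Ex; [right|left].
have dis c : E c `&` E (~~ c) = set0.
  apply/seteqP; split => // x; case: c => /= -[x1 x2]; suff : set0 x by [].
    by rewrite -E1; split => //; exact: subset_closure.
  by rewrite -E1; split => //; exact: subset_closure.
have Ecl c : closed (E c).
  move=> x Ex; have : quasi_component x.
    by apply: quasi_component_closed; apply: closureS Ex; exact: Qsub.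
  rewrite QE; case: c Ex => Ex [] Ex' //; suff : set0 x by [].
    by rewrite -E2.
  by rewrite -E1.
have [|V [Vo EV VE]] := closed_shrinking (Ecl b) (subset_trans (Qsub b) quasi_component_sub)
  (closed_openC (Ecl (~~ b))).
  by move=> x Ex Ex'; have : set0 x by rewrite -(dis b).
have [||C [Cp CA Ccl ACcl] CL] := @clopen_part_avoids (A `&` closure V `&` ~` V).
- apply: subclosed_compact Kc _.
    by apply: closedI; [apply: closedI => //; exact: closed_closure | exact: open_closedC].
  by move=> x [[/AK /interior_subset]].
- apply/seteqP; split=> // x [[[_ Vx] nVx]]; rewrite QE => Ex.
  have [Ebx|Enx] : E b x \/ E (~~ b) x by case: (b); [case: Ex; [right|left] | exact: Ex].
    exact: nVx (EV _ Ebx).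
  exact: VE Vx Enx.
have CV : C `&` V = C `&` closure V.
  apply/seteqP; split=> x [Cx Vx]; split => //; first exact: subset_closure.
  by apply: contrapT => nVx; suff : set0 x by []; rewrite -CL; split=> //; split=> //;
    split=> //; exact: CA.
have Dc : clopen_part (C `&` V).
  split.
  - by split => //; exact: EV.
  - by move=> x [/CA].
  - by rewrite CV; apply: closedI => //; exact: closed_closure.
  - rewrite setDIr; apply: closedU => //; rewrite setDE.
    by apply: closedI => //; exact: open_closedC.
have [x Ex] := E0 (~~ b).
have [_ Vx] := Qsub _ _ Ex _ Dc.
exact: VE (subset_closure Vx) Ex.
Qed.

Lemma component_avoids (L : set T) : closed L -> connected_component A p `&` L = set0 ->
  exists2 C, clopen_part C & C `&` L = set0.
Proof.
move=> Lcl LK.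
have [||C Cc CL] := @clopen_part_avoids (A `&` L).
- apply: subclosed_compact Kc _; first exact: closedI.
  by move=> x [/AK /interior_subset].
- apply/seteqP; split=> // x [[_ Lx] Qx]; rewrite -LK; split => //.
  by apply: connected_component_max Qx;
    [move=> C [] | exact: quasi_component_sub | exact: quasi_component_connected].
exists C => //; apply/seteqP; split=> // x [Cx Lx]; rewrite -CL; split => //; split => //.
by case: Cc => _ CA _ _; exact: CA.
Qed.

End QuasiComponents.

(** * The Euclidean norm *)

Section EuclideanNorm.
Variables (R : realType) (n : nat).
Local Notation C := R[i].
Implicit Types z : 'rV[C]_n.

Lemma continuous_sum (T : topologicalType) (I : Type) (s : seq I) (F : I -> T -> R) :
  (forall i, continuous (F i)) -> continuous (fun x => \sum_(i <- s) F i x).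
Proof.
move=> cF; elim: s => [|i s IH] x.
  rewrite (_ : (fun x => _) = fun=> 0); first exact: cst_continuous.
  by apply/funext => y; rewrite big_nil.
rewrite (_ : (fun x => _) = fun y => F i y + \sum_(j <- s) F j y).
  exact: (@cvgD R R^o T (nbhs x) _ (F i) (fun y => \sum_(j <- s) F j y) _ _ (cF i x) (IH x)).
by apply/funext => y; rewrite big_cons.
Qed.

Lemma enorm_continuous : continuous (@enorm R n).
Proof.
move=> z; apply: (@continuous_comp _ _ _ (fun z :
  'rV[C]_n => \sum_(i < n) (complex.Re (z ord0 i) ^+ 2
                          + complex.Im (z ord0 i) ^+ 2)) Num.sqrt); last exact: sqrt_continuous.
apply: continuous_sum => i {}z.
have cRe : {for z, continuous (fun z : 'rV[C]_n => complex.Re (z ord0 i))}.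
  apply: (@continuous_comp _ _ _ (fun z : 'rV[C]_n => z ord0 i) (@complex.Re R));
    first exact: continuous_at_coord.
  exact: continuous_Re.
have cIm : {for z, continuous (fun z : 'rV[C]_n => complex.Im (z ord0 i))}.
  apply: (@continuous_comp _ _ _ (fun z : 'rV[C]_n => z ord0 i) (@complex.Im R));
    first exact: continuous_at_coord.
  exact: continuous_Im.
apply: (@cvgD R R^o _ (nbhs z) _ (fun z : 'rV[C]_n => complex.Re (z ord0 i) ^+ 2)
  (fun z : 'rV[C]_n => complex.Im (z ord0 i) ^+ 2)).
  exact: (@cvgM R _ (nbhs z) _ _ _ _ _ cRe cRe).
exact: (@cvgM R _ (nbhs z) _ _ _ _ _ cIm cIm).
Qed.

Lemma enormZ (t : R) z : 0 <= t -> enorm (t%:C%C *: z) = t * enorm z.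
Proof.
move=> t0; rewrite /enorm.
under eq_bigr => i _.
  have -> : complex.Re ((t%:C%C *: z) ord0 i) ^+ 2 + complex.Im ((t%:C%C *: z) ord0 i) ^+ 2 =
    t ^+ 2 * (complex.Re (z ord0 i) ^+ 2 + complex.Im (z ord0 i) ^+ 2).
    by rewrite mxE; case: (z ord0 i) => a b /=; ring.
  over.
by rewrite -mulr_sumr sqrtrM ?sqr_ge0 // sqrtr_sqr ger0_norm.
Qed.

Lemma enorm_sq_ge0 z i : 0 <= complex.Re (z ord0 i) ^+ 2 + complex.Im (z ord0 i) ^+ 2.
Proof. by rewrite addr_ge0 // sqr_ge0. Qed.

Lemma enorm_coord z i :
  complex.Re (z ord0 i) ^+ 2 + complex.Im (z ord0 i) ^+ 2 <= enorm z ^+ 2.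
Proof.
rewrite sqr_sqrtr; last by apply: sumr_ge0 => j _; exact: enorm_sq_ge0.
by rewrite (bigD1 i) //= lerDl sumr_ge0 // => j _; exact: enorm_sq_ge0.
Qed.

Lemma enorm_ge0 z : 0 <= enorm z.
Proof. exact: sqrtr_ge0. Qed.

Lemma enorm0 : enorm (0 : 'rV[C]_n) = 0.
Proof. by have := @enormZ 0 0 (lexx 0); rewrite scaler0 mul0r. Qed.

Lemma enorm_gt0 z : z != 0 -> 0 < enorm z.
Proof.
move=> z0; rewrite lt0r enorm_ge0 andbT; apply: contra z0 => /eqP z0.
apply/eqP/rowP => i; rewrite mxE; have := enorm_coord z i; rewrite z0 expr0n /=.
case: (z ord0 i) => a b /= h; apply/eqP; rewrite eq_complex /=.
have : a ^+ 2 + b ^+ 2 == 0 by rewrite eq_le h addr_ge0 ?sqr_ge0.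
by rewrite paddr_eq0 ?sqr_ge0 // !sqrf_eq0.
Qed.

Lemma eball_polybox r : @eball R n r `<=` polybox r.
Proof.
move=> z zr i; have r0 : 0 <= r by apply: le_trans zr; exact: enorm_ge0.
have zr' : enorm z ^+ 2 <= r ^+ 2.
  by apply: lerXn2r; rewrite ?nnegrE ?enorm_ge0.
have h := le_trans (enorm_coord z i) zr'.
split; rewrite -(@ler_pXn2r _ 2) ?nnegrE // real_normK ?num_real // (le_trans _ h) //.
- by rewrite lerDl sqr_ge0.
- by rewrite lerDr sqr_ge0.
Qed.

End EuclideanNorm.

(** * Approximation of holomorphic maps by finite polynomial maps *)

Section HolomorphicMaps.
Variables (R : realType) (n : nat).
Local Notation C := R[i].
Variable f : 'rV[C]_n -> 'rV[C]_n.
Hypothesis hf : holomorphic f.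

Lemma holomorphic_continuous : continuous f.
Proof. by move=> z; apply: differentiable_continuous; exact: hf. Qed.

Lemma holomorphic_separately i : separately_holomorphic (fun v => f v ord0 i).
Proof.
move=> c k t; pose a := set_coord c k t; pose d : 'rV[C]_n := \row_j (j == k)%:R.
have upE z : set_coord c k z = (z - t) *: d + a.
  by apply/rowP => j; rewrite !mxE; case: eqP => _; rewrite ?mulr1 ?subrK // mulr0 add0r.
have /cvg_ex[L fL] : derivable f a d by apply: diff_derivable; exact: hf.
pose gam z := if z == t then L ord0 i else (f (set_coord c k z) ord0 i - f a ord0 i) / (z - t).
exists gam; last first.
  move=> z; rewrite /gam; case: eqP => [->|/eqP zt]; first by rewrite subrr mul0r addr0.
  by rewrite mulrC divfK ?subr_eq0 // addrC subrK.
have gamt : gam t = L ord0 i by rewrite /gam eqxx.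
apply: dist_continuous => e e0.
have : \forall h \near (0 : C)^', `|L - h^-1 *: ((f \o shift a) (h *: d) - f a)| < e.
  exact: (@cvgr_dist_lt _ _ _ _ _ _ L fL).
move=> /nbhs_ballP[r /= r0 rP]; apply/nbhs_ballP; exists r => // z.
rewrite -ball_normE /= gamt /gam; case: eqP => [_|/eqP zt] tz; first by rewrite subrr normr0.
have := rP (z - t); rewrite -ball_normE /= sub0r normrN distrC => /(_ tz).
rewrite subr_eq0 => /(_ zt) /(le_lt_trans (coord_norm_le _ i)).
by rewrite !mxE -upE mulrC.
Qed.

(** Approximate each component by a polynomial, take N larger than all the degrees and
    add eta z_i^N, with eta so small that this term is negligible on the bounded set
    considered. *)
Lemma holomorphic_approx (rho : R) (e : C) : 0 < rho -> 0 < e ->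
  exists (N : nat) (Q : 'I_n -> mpoly.mpoly n C) (eta : C),
  [/\ (0 < N)%N, forall i, FiniteMap.deg_lt N (Q i), 0 < eta &
    forall z, polybox rho z -> `|f z - eta *: polymap N Q z| <= e].
Proof.
move=> rho0 e0; have e20 : 0 < e / 2 by rewrite divr_gt0.
have /fin_all_exists[P PP] i : exists P : mpoly.mpoly n C, forall v, polybox rho v ->
    `|f v ord0 i - mpoly.meval (v ord0) P| <= e / 2.
  have [|p [P pP] pf] := polynomial_density rho0 _ (holomorphic_separately i) e20.
    move=> z; apply: (@continuous_comp _ _ _ f (fun v : 'rV[C]_n => v ord0 i)).
      exact: holomorphic_continuous.
    exact: continuous_at_coord.
  by exists P => v /pf; rewrite pP.
have [N N0 PN] := FiniteMap.ex_deg_lt P.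
pose b : C := (1 + (rho + rho))%:C%C.
have b1 : 1 <= b by rewrite -[1]/(1%:C%C) lecR; lra.
have bN : 0 < b ^+ N by rewrite exprn_gt0 // (lt_le_trans ltr01).
pose eta := e / 2 / b ^+ N; have eta0 : 0 < eta by rewrite divr_gt0.
have /fin_all_exists2[Q QN QE] i : exists2 q, FiniteMap.deg_lt N q &
  forall v, mpoly.meval v q = eta^-1 * mpoly.meval v (P i) by exact: FiniteMap.deg_ltZ.
exists N, Q, eta; split => // z zX; apply: norm_rV_le => [|i]; first exact: ltW.
rewrite !mxE QE mulrDr mulVKf ?gt_eqF // opprD addrCA addrC.
rewrite (le_trans (ler_normB _ _)) // [e]splitr lerD ?PP //.
have zb : `|z ord0 i| ^+ N <= b ^+ N.
  apply: lerXn2r; rewrite ?nnegrE ?(le_trans ler01 b1) //.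
  by apply: (le_trans (cbox_norm (zX i))); rewrite lecR; lra.
rewrite normrM normrX (gtr0_norm eta0) (le_trans (ler_wpM2l (ltW eta0) zb)) //.
by rewrite /eta divfK // gt_eqF.
Qed.

End HolomorphicMaps.

(** * Islands *)

Section Islands.
Variables (R : realType) (n : nat).
Local Notation C := R[i].
Variable f : 'rV[C]_n -> 'rV[C]_n.
Hypothesis hf : holomorphic f.

Lemma enorm_f_continuous : continuous (fun z => enorm (f z)).
Proof.
move=> z; apply: (@continuous_comp _ _ _ f (@enorm R n)).
  exact: holomorphic_continuous.
exact: enorm_continuous.
Qed.

Lemma closed_enorm_le (g : 'rV[C]_n -> 'rV[C]_n) (d : R) :
  continuous (fun z => enorm (g z)) -> closed [set z | enorm (g z) <= d].
Proof.
move=> cg; apply: (@closed_comp _ _ (fun z => enorm (g z)) [set x | x <= d]).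
  by move=> z _; exact: cg.
exact: closed_le.
Qed.

(** Balls are star-shaped, hence contained in the component of their centre. *)
Lemma component_nbhs (A : set 'rV[C]_n) z : nbhs z A -> nbhs z (connected_component A z).
Proof.
move=> /nbhs_ballP[e /= e0 zA]; apply/nbhs_ballP; exists e => // x zx.
pose path (t : R) : 'rV[C]_n := z + t%:C%C *: (x - z).
have cpath : continuous path.
  move=> t; apply: continuous_at_rV => i.
  rewrite (_ : (fun s => path s ord0 i) = (fun s : R => z ord0 i + s%:C%C * (x - z) ord0 i));
    last first.
    by apply/funext => s; rewrite !mxE.
  apply: (@continuous_atD _ R t (fun=> z ord0 i) (fun s : R => s%:C%C * (x - z) ord0 i));
    first exact: continuous_at_cst.
  apply: (@continuous_atM _ R t (fun s : R => s%:C%C) (fun=> (x - z) ord0 i));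
    last exact: continuous_at_cst.
  exact: continuous_real_complex.
exists (path @` `[0, 1]).
  split.
  - by exists 0; rewrite /path /= ?in_itv /= ?lexx ?ler01 // scale0r addr0.
  - move=> _ [t /= + <-]; rewrite in_itv /= => /andP[t0 t1]; apply: zA.
    move: zx; rewrite -!ball_normE /= => zx; rewrite /path opprD addNKr normrN normrZ.
    rewrite normc_real_complex ger0_norm // distrC in zx *.
    by apply: le_lt_trans zx; rewrite ler_piMl // -[1]/(1%:C%C) lecR.
  - apply: connected_continuous_connected; first exact: segment_connected.
    exact: continuous_subspaceT.
exists 1; rewrite /path /= ?in_itv /= ?lexx ?ler01 //.
by rewrite scale1r addrC subrK.
Qed.

Lemma zero_interior (r delta : R) (K : set 'rV[C]_n) z : 0 < delta ->
  island f r delta K -> K z -> f z = 0 -> K° z.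
Proof.
move=> d0 [[p Ap ->] Ksph] Kz fz0; set A := (_ `&` _) in Ap Ksph Kz *.
have [_ zr] := connected_component_sub Kz.
have zint : (@eball R n r)° z.
  apply: contrapT => nz; suff : set0 z by [].
  by rewrite -Ksph; split => //; split => //; exact: subset_closure.
rewrite (same_connected_component Kz) /interior /=.
apply: component_nbhs; apply: filterI => //.
have := continuous_dist (@enorm_f_continuous z) d0.
apply: filterS => y; rewrite fz0 enorm0 sub0r normrN ger0_norm ?enorm_ge0 // => /ltW.
exact.
Qed.

(** Strict inequalities between continuous functions on a compact set are stable. *)
Lemma perturbation (D W : set 'rV[C]_n) p : compact D -> compact W ->
  (forall x, D x -> enorm (f p) < enorm (f x)) -> (forall x, W x -> f x != 0) ->
  exists2 e : C, 0 < e & forall P : 'rV[C]_n -> 'rV[C]_n,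
    `|P p - f p| < e -> (forall x, D x \/ W x -> `|P x - f x| < e) ->
    (forall x, D x -> enorm (P p) < enorm (P x)) /\ (forall x, W x -> P x != 0).
Proof.
move=> Dc Wc fD fW.
have cadd x : {for (x, 0 : 'rV[C]_n), continuous (fun y : 'rV[C]_n * 'rV[C]_n => f y.1 + y.2)}.
  apply: (@cvgD C 'rV[C]_n _ (nbhs (x, 0 : 'rV[C]_n)) _ (fun y => f y.1) snd);
    last exact: cvg_snd.
  apply: (@continuous_comp _ _ _ fst f); first exact: cvg_fst.
  exact: holomorphic_continuous.
have caddE x : {for (x, 0 : 'rV[C]_n), continuous (fun y :
  'rV[C]_n * 'rV[C]_n => enorm (f y.1 + y.2))}.
  apply: (@continuous_comp _ _ _ (fun y : 'rV[C]_n * 'rV[C]_n => f y.1 + y.2) (@enorm R n));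
    first exact: cadd.
  exact: enorm_continuous.
pose PD (u : 'rV[C]_n * 'rV[C]_n) x : Prop := enorm (f p + u.2) < enorm (f x + u.1).
have nD : filter_prod (nbhs (0 : 'rV[C]_n)) (nbhs (0 : 'rV[C]_n)) (fun u => D `<=` PD u).
  apply: ((compact_near_coveringP D).1 Dc _
    (filter_prod (nbhs (0 : 'rV[C]_n)) (nbhs (0 : 'rV[C]_n))) PD _) => x Dx.
  have e0 : 0 < (enorm (f x) - enorm (f p)) / 2 by rewrite divr_gt0 // subr_gt0 fD.
  have [[A1 A2] /= [A1x A20] AP] := continuous_dist (caddE x) e0.
  have [[B1 B2] /= [B1x B20] BP] := continuous_dist (caddE p) e0.
  exists (A1, [set u | A2 u.1 /\ B2 u.2]).
    by split => //; exists (A2, B2).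
  move=> [y [u u']] [/= A1y [A2u B2u]].
  have := AP (y, u) (conj A1y A2u); have := BP (p, u') (conj (nbhs_singleton B1x) B2u) => /=.
  by rewrite /PD /= !addr0 !ltr_norml => /andP[h1 h2] /andP[h3 h4]; lra.
pose PW (u : 'rV[C]_n) x : Prop := f x + u != 0.
have nW : nbhs (0 : 'rV[C]_n) (fun u => W `<=` PW u).
  apply: ((compact_near_coveringP W).1 Wc _ (nbhs (0 : 'rV[C]_n)) PW _) => x Wx.
  have e0 : 0 < `|f x| by rewrite normr_gt0 fW.
  have [[A1 A2] /= [A1x A20] AP] := continuous_dist (cadd x) e0.
  exists (A1, A2) => // -[y u] /= Ayu; have := AP (y, u) Ayu; rewrite /PW /= addr0.
  by apply: contraTneq => ->; rewrite subr0 ltxx.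
move: nD nW => [[U1 U2] /= [/nbhs_ballP[e1 /= e10 eU1] /nbhs_ballP[e2 /= e20 eU2]] UP].
move=> /nbhs_ballP[e3 /= e30 eW].
have [e [e0 [ee1 ee2 ee3]]] : exists e : C, 0 < e /\ [/\ e <= e1, e <= e2 & e <= e3].
  move: e1 e2 e3 e10 e20 e30 {eU1 eU2 eW} => _ _ _ /gt0_realP[a a0 ->] /gt0_realP[b b0 ->]
    /gt0_realP[c c0 ->].
  exists (Num.min a (Num.min b c))%:C%C; rewrite ltcR !lecR !lt_min a0 b0 c0; split => //.
  by split; rewrite !ge_min lexx ?orbT.
exists e => // P Pp PDW; have inb (e' : C) (u : 'rV[C]_n) : e <= e' -> `|u| < e ->
  ball (0 : 'rV[C]_n) e' u.
  by move=> ee' ue; rewrite -ball_normE /= sub0r normrN (lt_le_trans ue).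
split=> x xX.
  have := UP (P x - f x, P p - f p) _ x xX; rewrite /PD /= ![f _ + _]addrC !subrK; apply.
  by split; [apply: eU1; apply: inb => //; apply: PDW; left | apply: eU2; exact: inb].
have := eW (P x - f x) _ x xX; rewrite /PW ![f _ + _]addrC !subrK; apply.
by apply: inb => //; apply: PDW; right.
Qed.

(** The contradiction comes from minimising the Euclidean norm of an approximation [P]
    of [f] over a compact neighbourhood [W] of a clopen part without zeros. *)
Lemma island_has_zero (r delta : R) (K : set 'rV[C]_n) : 0 < r ->
  island f r delta K -> exists2 z, K z & f z = 0.
Proof.
move=> r0 [[p Ap ->] Ksph]; set A := (_ `&` _) in Ap Ksph *.
apply: contrapT => nozero.
have Acl : closed A.
  by apply: closedI; apply: closed_enorm_le;
    [exact: enorm_f_continuous | exact: enorm_continuous].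
have Abox : A `<=` polybox r by move=> x [_ /eball_polybox].
have AK : A `<=` (@polybox R n (r + 1))°.
  move=> x /Abox xr; apply/nbhs_ballP; exists 1 => //= y; rewrite -ball_normE /= => xy i.
  have [xr1 xi1] := xr i; have := le_lt_trans (coord_norm_le _ i) xy; rewrite !mxE => xyi.
  have := le_lt_trans (normc_Re _) xyi; have := le_lt_trans (normc_Im _) xyi.
  rewrite -[1]/(1%:C%C) !ltcR; move: xr1 xi1.
  case: (x ord0 i) (y ord0 i) => [a b] [c d] /=; rewrite !ltr_norml !ler_norml.
  move=> /andP[? ?] /andP[? ?] /andP[? ?] /andP[? ?].
  by split; rewrite /= ler_norml; apply/andP; split; lra.
pose L := @esphere R n r `|` [set z | f z = 0].
have Lcl : closed L.
  apply: closedU.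
    by apply: closedI; [exact: closed_closure | exact/open_closedC/open_interior].
  apply: (@closed_comp _ _ f [set 0]); first by move=> z _; exact: holomorphic_continuous.
  exact: (accessible_closed_set1 (hausdorff_accessible (@norm_hausdorff _ _))).
have [|A0 [Cp CA Ccl ACcl] CL] := @component_avoids _ _ A p (@norm_hausdorff _ _)
    (@compact_polybox R n (r + 1)) AK Acl Ap L Lcl.
  apply/seteqP; split => // x [Kx [Sx|fx0]]; first by rewrite -Ksph.
  by apply: nozero; exists x.
(* [W] will be the closure of an open set squeezed between A0 and [O] *)
pose O := (@eball R n r)° `&` ~` (A `\` A0) `&` [set z | f z != 0].
have Oo : open O.
  apply: openI; first by apply: openI; [exact: open_interior | exact: closed_openC].
  rewrite (_ : [set z | f z != 0] = ~` [set z | f z = 0]); last first.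
    by apply/seteqP; split => z /= /eqP.
  apply: closed_openC; apply: (@closed_comp _ _ f [set 0]); first by move=> z _;
    exact: holomorphic_continuous.
  exact: (accessible_closed_set1 (hausdorff_accessible (@norm_hausdorff _ _))).
have CO : A0 `<=` O.
  move=> x Cx; have nL : ~ L x by move=> Lx; have : set0 x by rewrite -CL.
  split; first split.
  - apply: contrapT => nx; apply: nL; left; split => //; apply: subset_closure.
    by have [] := CA _ Cx.
  - by move=> [].
  - by apply/eqP => fx0; apply: nL; right.
have [V [Vo CV VO]] := closed_shrinking (@norm_hausdorff _ _) (@compact_polybox R n (r + 1))
  AK Ccl CA Oo CO.
pose W := closure V; pose D := W `\` V.
have Wball : W `<=` @eball R n r by move=> x /VO[[/interior_subset]].
have Wc : compact W.
  apply: (subclosed_compact (@closed_closure _ _) (@compact_polybox R n r)).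
  by move=> x /Wball /eball_polybox.
have Dc : compact D.
  apply: (subclosed_compact _ Wc) => [|x []//].
  by apply: closedI; [exact: closed_closure | exact: open_closedC].
have fD x : D x -> enorm (f p) < enorm (f x).
  move=> [Wx nVx]; have [fp _] := Ap; apply: (le_lt_trans fp).
  rewrite ltNge; apply/negP => fx; have [[_ nAC] _] := VO _ Wx.
  apply: nVx; apply: CV; apply: contrapT => nCx; apply: nAC; split => //.
  by split => //; exact: Wball.
have fW x : W x -> f x != 0 by move=> /VO[].
have [e e0 stab] := perturbation Dc Wc fD fW.
have e20 : 0 < e / 2 by rewrite divr_gt0.
have [N [Q [eta [N0 QN eta0 approx]]]] := holomorphic_approx hf r0 e20.
pose P z := eta *: polymap N Q z.
have Pf x : W x -> `|P x - f x| < e.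
  move=> /Wball/eball_polybox/approx h; rewrite distrC (le_lt_trans h) //.
  by rewrite ltr_pdivrMr // ltr_pMr // ltr1n.
have Wp : W p by exact/subset_closure/CV.
have [|PD PW] := stab P (Pf _ Wp); first by move=> x [[]|]; [move=> Wx _|]; exact: Pf.
have cP : continuous (fun z => enorm (P z)).
  move=> z; apply: (@continuous_comp _ _ _ P (@enorm R n)); last exact: enorm_continuous.
  exact: (@cvgZ C 'rV[C]_n _ (nbhs z) _ (fun=> eta) (polymap N Q) eta _ (cvg_cst _)
    (@polymap_continuous R n N Q z)).
have [||z0 /set_mem Wz0 zmin] := compact_EVT_min _ Wc (f := fun z => enorm (P z)) _.
- by exists p.
- exact: continuous_subspaceT.
have Vz0 : V z0.
  apply: contrapT => nV; have := PD z0 (conj Wz0 nV); rewrite ltNge => /negP; apply.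
  by apply: zmin; rewrite inE.
have Pz0 : 0 < enorm (P z0) by apply: enorm_gt0; exact: PW.
have scaled : continuous (fun t : R => t%:C%C *: polymap N Q z0).
  move=> t; exact: (@cvgZ C 'rV[C]_n R (nbhs t) _ (fun t : R => t%:C%C)
    (fun=> polymap N Q z0) _ _ (@continuous_real_complex R t) (cvg_cst _)).
(* [polymap N Q] is open, so it takes the values t * F(z0) near z0 for t near 1 *)
have : \forall t \near (1 : R), exists2 z, V z & polymap N Q z = t%:C%C *: polymap N Q z0.
  apply: (scaled 1 [set w | exists2 z, V z & polymap N Q z = w]).
  by rewrite scale1r; exact: (polymap_open N0 QN (open_nbhs_nbhs (conj Vo Vz0))).
move=> /nbhs_ballP[s /= s0 sP].
(* t is in the ball of radius s around 1 and strictly between 0 and 1 *)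
pose t : R := 1 - Num.min (s / 2) (1 / 2).
have m0 : 0 < Num.min (s / 2) (1 / 2) by rewrite lt_min; apply/andP; split; apply: divr_gt0.
have ms : Num.min (s / 2) (1 / 2) <= s / 2 by rewrite ge_min lexx.
have m1 : Num.min (s / 2) (1 / 2) <= 1 / 2 by rewrite ge_min lexx orbT.
have [|z Vz zt] := sP t.
  rewrite -ball_normE /= /t opprB addrC subrK gtr0_norm //; lra.
have Pz : P z = t%:C%C *: P z0 by rewrite /P zt !scalerA mulrC.
have := zmin z; rewrite inE => /(_ (subset_closure Vz)).
rewrite Pz enormZ; last by rewrite /t; lra.
by rewrite leNgt -[X in _ < X]mul1r ltr_pM2r // /t; apply/negP/negPn; lra.
Qed.

End Islands.

Theorem theorem1p6 (R : realType) (n : nat) (hn : (0 < n)%N)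
    (f : 'rV[R[i]]_n -> 'rV[R[i]]_n) (hf : holomorphic f)
    (r delta : R) (hr : 0 < r) (hdelta : 0 < delta)
    (K : set 'rV[R[i]]_n) (hK : island f r delta K) :
  K° !=set0 /\ exists z, K° z /\ f z = 0.
Proof.
have [z Kz fz0] := island_has_zero hf hr hK.
have Kz' := zero_interior hf hdelta hK Kz fz0.
by split; exists z.
Qed.
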